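(* Let $n \geq 3$ and $1 \leq i \leq n-2$ be integers, and let $L_{i,n} = K_1 \cup K_2 \cup K_3 \subset \mathbb{R}^n$ be the three-component link consisting of the round $(n-2)$-sphere $K_1$, the round $(n-i-1)$-sphere $K_2$ and the $i$-dimensional ellipsoid $K_3$ given by \begin{align*} K_1 &= \{(x_1,\dots,x_n) : x_1^2 + x_2^2 + \dots + x_{n-1}^2 = 4,\ x_n = 0\},\\ K_2 &= \{(x_1,\dots,x_n) : x_{i+1}^2 + x_{i+2}^2 + \dots + x_n^2 = 9,\ x_1 = x_2 = \dots = x_i = 0\},\\ K_3 &= \{(x_1,\dots,x_n) : x_1^2 + \dots + x_i^2 + \tfrac{x_n^2}{16} = 1,\ x_{i+1} = \dots = x_{n-1} = 0\}. \end{align*} Then $L_{i,n}$ is a convex Brunnian link in $\mathbb{R}^n$.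
   Context: A knot in $\mathbb{R}^n$ is a subset $K \subset \mathbb{R}^n$ homeomorphic to $S^k$ for some $k$. A link in $\mathbb{R}^n$ is a subset of $\mathbb{R}^n$ that is homeomorphic to a disjoint union of finitely many knots (its components), possibly of different dimensions. A link $L = F_1 \cup \dots \cup F_m$ in $\mathbb{R}^n$ is an unlink in $\mathbb{R}^n$ if for each $k$ the knot $F_k$ bounds a ball $B_k$ (of the appropriate dimension, $\dim F_k + 1$) such that $B_k \cap F_j = \emptyset$ for all $j \neq k$. A link in $\mathbb{R}^n$ of $m \geq 3$ components is a Brunnian link in $\mathbb{R}^n$ if it is not an unlink in $\mathbb{R}^n$ but every proper sublink is an unlink in $\mathbb{R}^n$. A knot homeomorphic to $S^k$ is convex if it bounds a ball $B^{k+1}$ which is convex. A convex Brunnian link is a Brunnian link all of whose components are convex. *)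

(* Defs.v *)
From HB Require Import structures.
From mathcomp Require Import all_boot all_order all_algebra.
From mathcomp Require Import all_classical all_reals all_analysis.

Set Implicit Arguments.
Unset Strict Implicit.
Unset Printing Implicit Defensive.

Import Order.TTheory GRing.Theory Num.Theory.
Import numFieldNormedType.Exports.

Local Open Scope classical_set_scope.
Local Open Scope ring_scope.

Definition homeomorphism (X Y : topologicalType) (f : X -> Y) : Prop :=
  continuous f /\
  exists g : Y -> X, [/\ continuous g, cancel f g & cancel g f].

Definition homeomorphic (X Y : topologicalType) : Prop :=
  exists f : X -> Y, homeomorphism f.

(* The library's norm on row vectors is the max norm, hence the explicit sums
   of squares. [unit_sphere R k] is S^k, contained in R^(k+1). *)
Definition unit_sphere (R : realType) (k : nat) : set 'rV[R]_k.+1 :=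
  [set x | \sum_j x ord0 j ^+ 2 = 1].

Definition unit_disk (R : realType) (d : nat) : set 'rV[R]_d :=
  [set x | \sum_j x ord0 j ^+ 2 <= 1].

(* Here and below a set used as a type is its [set_type], with the subspace
   topology. *)
Definition knot (R : realType) (n : nat) (K : set 'rV[R]_n) : Prop :=
  exists k, homeomorphic (set_type K) (set_type (@unit_sphere R k)).

(* B is a topological ball whose boundary sphere is K; this forces the
   dimension of B to be dim K + 1. *)
Definition bounds_ball (R : realType) (n : nat) (K B : set 'rV[R]_n) : Prop :=
  exists (k : nat) (h : set_type (@unit_disk R k.+1) -> set_type B),
    homeomorphism h /\
    [set set_val (h x) | x in [set x | unit_sphere (set_val x)]] = K.

(* A link is given by the finite family F of its components: the canonical map
   from their disjoint union onto their union in R^n is a homeomorphism (so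
   the components are in particular pairwise disjoint). *)
Definition link (R : realType) (n : nat) (I : finType)
    (F : I -> set 'rV[R]_n) : Prop :=
  (forall k, knot (F k)) /\
  exists h : {k : I & set_type (F k)} -> set_type (\bigcup_k F k),
    homeomorphism h /\
    forall (k : I) (x : set_type (F k)),
      set_val (h (existT (fun j => set_type (F j)) k x)) = set_val x.

Definition unlink (R : realType) (n : nat) (I : finType)
    (F : I -> set 'rV[R]_n) : Prop :=
  link F /\
  forall k, exists B : set 'rV[R]_n,
    bounds_ball (F k) B /\ forall j, j <> k -> B `&` F j = set0.

Definition sublink (R : realType) (n : nat) (I : finType)
    (F : I -> set 'rV[R]_n) (A : {set I}) :
    {k : I | k \in A} -> set 'rV[R]_n :=
  fun k => F (val k).

Definition brunnian_link (R : realType) (n : nat) (I : finType)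
    (F : I -> set 'rV[R]_n) : Prop :=
  [/\ link F, (3 <= #|I|)%N, ~ unlink F &
      forall A : {set I}, A \proper [set: I]%SET -> unlink (sublink F (A := A))].

Definition convex_knot (R : realType) (n : nat) (K : set 'rV[R]_n) : Prop :=
  knot K /\ exists B : set 'rV[R]_n, bounds_ball K B /\ convex_set B.

Definition convex_brunnian_link (R : realType) (n : nat) (I : finType)
    (F : I -> set 'rV[R]_n) : Prop :=
  brunnian_link F /\ forall k, convex_knot (F k).

(* The coordinate x_k of x = (x_1, ..., x_n), numbered from 1; it is only used
   for 1 <= k <= n. *)
Definition coord1 (R : realType) (n : nat) (x : 'rV[R]_n) (k : nat) : R :=
  if insub k.-1 is Some j then x ord0 j else 0.

Definition K1 (R : realType) (n : nat) : set 'rV[R]_n :=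
  [set x | \sum_(1 <= j < n) coord1 x j ^+ 2 = 4 /\ coord1 x n = 0].

Definition K2 (R : realType) (n i : nat) : set 'rV[R]_n :=
  [set x | \sum_(i.+1 <= j < n.+1) coord1 x j ^+ 2 = 9 /\
           forall j, (1 <= j <= i)%N -> coord1 x j = 0].

Definition K3 (R : realType) (n i : nat) : set 'rV[R]_n :=
  [set x | \sum_(1 <= j < i.+1) coord1 x j ^+ 2 + coord1 x n ^+ 2 / 16 = 1 /\
           forall j, (i.+1 <= j <= n.-1)%N -> coord1 x j = 0].

Arguments K1 R n : clear implicits.
Arguments K2 R n i : clear implicits.
Arguments K3 R n i : clear implicits.

Definition L_link (R : realType) (n i : nat) : 'I_3 -> set 'rV[R]_n :=
  tnth [tuple K1 R n; K2 R n i; K3 R n i].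
Arguments L_link R n i : clear implicits.

(* Main.v *)
(** Write x = (u, v, t) with u the first i coordinates and t the last one.
    The flat ball bounded by K1 avoids K2, that of K2 avoids K3 and that of K3
    avoids K1; the cone over K1 (resp. K2, K3) with a far away apex on the axis of
    t (resp. u, v) avoids K3 (resp. K1, K2).  Hence proper sublinks are unlinks.

    Suppose that K3 bounds a ball B disjoint from K1 and K2.  On B the function
    w = (|x|^2 - 4) + i t does not vanish, so it has a continuous square root z
    on B: we lift B to the double covering of the complement of K1.  The map
      Phi = (u, min (|x|^2 - 9, Re z)) : B -> R^(i+1)
    does not vanish either: where Re z = 0 we have w <= 0, hence |x|^2 < 9, and
    a zero of Phi with Re z > 0 lies on K2.  But Im z has a constant sign on K3,
    since w is never positive there, so Re z has the sign of t up to a global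
    sign, and the restriction of Phi to K3 is never a nonpositive multiple of
    (u, t).  As B is contractible this contradicts the Poincaré-Bohl theorem.

    Poincaré-Bohl is deduced from Poincaré-Miranda, and the latter from a
    Sperner lemma for cubical grids, proved by computing with coefficients in
    F_2 the cup product of the coboundaries of the labels and applying Stokes'
    formula. *)

Require Import Defs.
From mathcomp Require Import all_boot all_order all_algebra.
From mathcomp Require Import all_classical all_reals all_analysis.
From mathcomp Require Import ring lra.

Set Implicit Arguments.
Unset Strict Implicit.
Unset Printing Implicit Defensive.

Import Order.TTheory GRing.Theory Num.Theory.
Import numFieldNormedType.Exports.

Local Open Scope classical_set_scope.
Local Open Scope ring_scope.

(** * A cubical Sperner lemma *)

Section CubicalCochains.
Variables (m : nat) (F : comNzRingType).
Hypothesis charF : 2%N \in [pchar F].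
Implicit Types (S : {set 'I_m}) (s : seq 'I_m) (j k : 'I_m).

Let pt := {ffun 'I_m -> nat}.
Implicit Types (v p q w : pt) (f : pt -> F) (l : seq 'I_m).
Variable a : 'I_m -> pt -> F.

Definition step_up v k : pt := [ffun j => (v j + (j == k))%N].
Definition upd v k c : pt := [ffun j => if j == k then c else v j].

(* The value of the cup product of the coboundaries of the [a i], for i in l, on
   the cube with lowest vertex v and edge directions S, triangulated by its
   monotone edge paths. *)
Fixpoint cup l S v : F :=
  if l is i :: l' then
    \sum_(k in S) (a i (step_up v k) - a i v) * cup l' (S :\ k) (step_up v k)
  else 1.

(** For a duplicate-free [s] this runs over the lowest vertices of the unit cubes of a grid with [N]
    steps in each direction of [s], the remaining coordinates being those of [v]. *)
Fixpoint grid_sum N s f v : F :=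
  if s is k :: s' then \sum_(c < N) grid_sum N s' f (upd v k c) else f v.

Lemma step_upC v j k : step_up (step_up v j) k = step_up (step_up v k) j.
Proof. by apply/ffunP => x; rewrite !ffunE -!addnA (addnC (x == j)). Qed.

Lemma updC v j k b c : j != k ->
  upd (upd v j b) k c = upd (upd v k c) j b.
Proof.
move=> jk; apply/ffunP => x; rewrite !ffunE; have [->|//] := eqVneq x k.
by rewrite eq_sym (negbTE jk).
Qed.

Lemma step_up_upd v k (c : nat) : step_up (upd v k c) k = upd v k c.+1.
Proof.
by apply/ffunP => x; rewrite !ffunE; case: eqVneq => _; rewrite (addn0, addn1).
Qed.

Lemma addFF (x : F) : x + x = 0.
Proof. by rewrite addrr_pchar2. Qed.

Lemma subFF (x y : F) : x - y = x + y.
Proof. by rewrite oppr_pchar2. Qed.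

(** The ordered pairs [(j, k)] and [(k, j)] give equal terms, which cancel in characteristic 2. *)
Lemma sum_sym_char2 S (G : 'I_m -> 'I_m -> F) :
  (forall j k, G j k = G k j) ->
  \sum_(j in S) \sum_(k in S :\ j) G j k = 0.
Proof.
move=> Gsym.
have -> : \sum_(j in S) \sum_(k in S :\ j) G j k =
  \sum_(j in S) \sum_(k in S | (j < k)%N) G j k +
  \sum_(j in S) \sum_(k in S | (k < j)%N) G j k.
  rewrite -big_split; apply: eq_bigr => j _ /=.
  rewrite (bigID (fun k : 'I_m => (j < k)%N)) /=; congr (_ + _).
    apply: eq_bigl => k; rewrite in_setD1 -andbA andbC -andbA.
    case: (k \in S) => //=; case: ltnP => //= jk.
    by rewrite -val_eqE /= gtn_eqF.
  apply: eq_bigl => k; rewrite in_setD1 -leqNgt ltn_neqAle val_eqE.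
  by rewrite -andbA; case: (k \in S) => //=; rewrite !andbF.
rewrite (exchange_big_dep (fun k => k \in S)) /=; last by move=> j k _ /andP[].
rewrite -big_split /= big1 // => k kS.
rewrite (eq_bigl (fun j : 'I_m => (j \in S) && (j < k)%N)) => [|j].
  by under eq_bigr do rewrite Gsym; rewrite addFF.
by rewrite kS.
Qed.

(** A product of coboundaries is a cocycle: its values on the front and back faces of a cube cancel.
    By induction on [l], the parts symmetric in two directions vanish by [sum_sym_char2], and the
    rest agrees after exchanging the directions. *)
Lemma cup_closed l S v :
  \sum_(k in S) cup l (S :\ k) (step_up v k) = \sum_(k in S) cup l (S :\ k) v.
Proof.
elim: l S v => [|i l IHl] S v //=.
have swap (G : 'I_m -> 'I_m -> F) :
    \sum_(j in S) \sum_(k in S :\ j) G j k =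
    \sum_(j in S) \sum_(k in S :\ j) G k j.
  rewrite (exchange_big_dep (fun k => k \in S)) /=; last by move=> j k _ /setD1P[].
  apply: eq_bigr => j jS; apply: eq_bigl => k.
  by rewrite !in_setD1 jS andbT andbC eq_sym.
under eq_bigr do under eq_bigr do rewrite subFF mulrDl.
under [RHS]eq_bigr do under eq_bigr do rewrite subFF mulrDl.
under eq_bigr do rewrite big_split/=.
under [RHS]eq_bigr do rewrite big_split/=.
rewrite !big_split/= sum_sym_char2 ?add0r; last first.
  move=> j k; rewrite step_upC; congr (_ * cup l _ _).
  by apply/setP => x; rewrite !inE andbCA.
have setD1C j k : S :\ j :\ k = S :\ k :\ j.
  by apply/setP => x; rewrite !inE andbCA.
(* The induction hypothesis removes the shift by [k], after which the summand is symmetric in [j]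
   and [k]. *)
have -> : \sum_(j in S) \sum_(k in S :\ j)
    a i v * cup l (S :\ j :\ k) (step_up v k) = 0.
  rewrite (eq_bigr (fun j => \sum_(k in S :\ j) a i v * cup l (S :\ j :\ k) v)).
    by apply: sum_sym_char2 => j k; rewrite setD1C.
  by move=> j _; rewrite -!mulr_sumr IHl.
rewrite addr0 [RHS]swap; apply: eq_bigr => j _.
rewrite -mulr_sumr IHl mulr_sumr; apply: eq_bigr => k _.
by rewrite setD1C.
Qed.

(** Leibniz rule: the factors in [l] form a cocycle, so multiplying them by the coboundary of [a i]
    gives the coboundary of their product with [a i]. *)
Lemma cup_exact i l S v :
  cup (i :: l) S v =
  \sum_(k in S) (a i (step_up v k) * cup l (S :\ k) (step_up v k) -
                 a i v * cup l (S :\ k) v).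
Proof.
rewrite /= sumrB -mulr_sumr -cup_closed mulr_sumr -sumrB.
by apply: eq_bigr => k _; rewrite mulrBl.
Qed.

Lemma grid_sum_upd N s f v k c : k \notin s ->
  grid_sum N s f (upd v k c) = grid_sum N s (fun w => f (upd w k c)) v.
Proof.
elim: s v => [//|j s IHs] v; rewrite in_cons negb_or => /andP[kj ks] /=.
by apply: eq_bigr => b _; rewrite updC// IHs.
Qed.

Lemma grid_sum_sum N s (I : finType) (P : pred I) (G : I -> pt -> F) v :
  grid_sum N s (fun w => \sum_(x | P x) G x w) v =
  \sum_(x | P x) grid_sum N s (G x) v.
Proof.
elim: s v => [//|k s IHs] v /=.
by rewrite exchange_big/=; apply: eq_bigr.
Qed.

Lemma eq_grid_sum N s f g v : f =1 g -> grid_sum N s f v = grid_sum N s g v.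
Proof. by move=> fg; elim: s v => //= k s IHs v; apply: eq_bigr. Qed.

(** Stokes' formula in one direction: interior faces cancel in pairs and only the two opposite sides
    of the grid remain. *)
Lemma grid_sum_telescope N s f v k : uniq s -> k \in s ->
  grid_sum N s (fun w => f (step_up w k) - f w) v =
  grid_sum N (rem k s) (fun w => f (upd w k N) - f (upd w k 0%N)) v.
Proof.
elim: s v => [//|j s IHs] v /= /andP[js us]; rewrite in_cons eq_sym.
have [<- _|jk /= ks] := eqVneq j k; last by apply: eq_bigr => c _; rewrite IHs.
under eq_bigr do rewrite grid_sum_upd//.
rewrite -grid_sum_sum; apply: eq_grid_sum => w.
under eq_bigr do rewrite step_up_upd.
by rewrite -(telescope_sumr (fun c => f (upd w j c)) (leq0n N)) big_mkord.
Qed.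

(** All vertices of the cube lie on the hyperplane where the label [a k] is constant, so the factor
    coming from its coboundary is zero. *)
Lemma cup_const0 l S v k c (b : F) : k \in l -> k \notin S -> v k = c ->
  (forall w, w k = c -> a k w = b) -> cup l S v = 0.
Proof.
move=> + + + ak; elim: l S v => [//|i l IHl] S v + kS vk.
have step_upk j : j \in S -> step_up v j k = c.
  move=> jS; rewrite ffunE vk.
  by case: eqVneq kS jS => [->/negbTE->//|]; rewrite addn0.
rewrite in_cons => /orP[/eqP <-|kl] /=; apply: big1 => j jS.
  by rewrite !ak ?step_upk// subrr mul0r.
by rewrite (IHl (S :\ j)) ?mulr0 ?step_upk// in_setD1 (negbTE kS) andbF.
Qed.

Hypothesis N : nat.
Hypothesis a0 : forall k v, v k = 0%N -> a k v = 0.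
Hypothesis aN : forall k v, v k = N -> a k v = 1.

(** Induction on the dimension: by [cup_exact] and Stokes the sum is a boundary term, to which only
    the side where coordinate [j] equals [N] contributes. There [a j] is 1 and the same sum in one
    dimension less is left. *)
Lemma grid_sum_cup s v : uniq s -> grid_sum N s (cup s [set k in s]) v = 1.
Proof.
elim: s v => [//|j s IHs] v us; have /andP[js us'] := us.
rewrite (eq_grid_sum _ _ _ (cup_exact _ _ _)) grid_sum_sum.
have updE w k c : upd w k c k = c by rewrite ffunE eqxx.
have step k : k \in j :: s ->
    grid_sum N (j :: s) (fun w =>
      a j (step_up w k) * cup s ([set i in j :: s] :\ k) (step_up w k) -
      a j w * cup s ([set i in j :: s] :\ k) w) v = (k == j)%:R.
  move=> ks.
  rewrite (grid_sum_telescope _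
    (fun w => a j w * cup s ([set i in j :: s] :\ k) w))//.
  have [->|kj] := eqVneq k j.
    rewrite /= eqxx; under eq_grid_sum => w.
      rewrite (aN (updE _ _ _)) (a0 (updE _ _ _)) mul1r mul0r subr0.
    over.
    have -> : [set i in j :: s] :\ j = [set i in s].
      by apply/setP => i; rewrite !inE; case: eqVneq => //= ->; rewrite (negbTE js).
    by rewrite -grid_sum_upd// IHs.
  (* On the two sides orthogonal to another direction [k], the label [a k] is constant and still
     among the factors. *)
  have ks' : k \in s by move: ks; rewrite in_cons (negbTE kj).
  have kS : k \notin [set i in j :: s] :\ k by rewrite !inE eqxx.
  rewrite (@eq_grid_sum N _ _ (fun=> 0)) => [|w].
    by elim: (rem _ _) v => //= i s' IH v; apply: big1.
  by rewrite (cup_const0 ks' kS (updE _ _ _) (aN (k := k)))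
     (cup_const0 ks' kS (updE _ _ _) (a0 (k := k))) !mulr0 subr0.
rewrite (eq_bigr (fun k => (k == j)%:R)) => [|k]; last by rewrite inE => /step.
rewrite (bigD1 j) ?inE ?eqxx//= big1 ?addr0// => k /andP[_ /negbTE->//].
Qed.

Lemma grid_sum_neq0 s f v : uniq s -> grid_sum N s f v != 0 ->
  exists w, [/\ f w != 0, forall k, k \in s -> (w k < N)%N
    & forall k, k \notin s -> w k = v k].
Proof.
elim: s v => [|j s IHs] v /=; first by move=> _ fv; exists v.
move=> /andP[js us].
have [c fc _|f0] :=
  pickP (fun c : 'I_N => grid_sum N s f (upd v j c) != 0); last first.
  by rewrite big1 ?eqxx// => c _; have := f0 c => /negbFE/eqP.
have [w [fw ws wv]] := IHs _ us fc.
exists w; split => // k; rewrite in_cons.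
  by case/orP=> [/eqP->|/ws//]; rewrite wv// ffunE eqxx.
by rewrite negb_or => /andP[kj ks]; rewrite wv// ffunE (negbTE kj).
Qed.

(** Some monotone edge path of the cube has only nonzero factors, and [p], [q] are the ends of the
    edge on which the label [a i] is differentiated. *)
Lemma cup_neq0 l S v : cup l S v != 0 -> forall i, i \in l ->
  exists p q, [/\ a i p != a i q,
    forall k, (v k <= p k <= v k + (k \in S))%N &
    forall k, (v k <= q k <= v k + (k \in S))%N].
Proof.
elim: l S v => [//|j l IHl] S v /= nz i.
have [k /andP[kS nzk]|z] := pickP (fun k => (k \in S) &&
   ((a j (step_up v k) - a j v) * cup l (S :\ k) (step_up v k) != 0)); last first.
  by move: nz; rewrite big1 ?eqxx// => k kS; have := z k; rewrite kS => /negbFE/eqP.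
rewrite in_cons => /orP[/eqP->|il].
  exists (step_up v k), v; split=> [|x|x].
  - by apply: contraNneq nzk => ->; rewrite subrr mul0r.
  - by rewrite ffunE leq_addr leq_add2l; case: eqVneq => [->|//]; rewrite kS.
  - by rewrite leqnn leq_addr.
have nz' : cup l (S :\ k) (step_up v k) != 0.
  by apply: contraNneq nzk => ->; rewrite mulr0.
have le x y : (step_up v k x <= y <= step_up v k x + (x \in S :\ k))%N ->
    (v x <= y <= v x + (x \in S))%N.
  rewrite ffunE in_setD1; case: eqVneq => [->|_] /=; last by rewrite addn0.
  by rewrite kS addn0 => /andP[h ->]; rewrite (leq_trans _ h) ?leq_addr.
have [p [q [pq hp hq]]] := IHl _ _ nz' _ il.
by exists p, q; split=> // x; apply: le.
Qed.

End CubicalCochains.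

(** The top cup products add up to 1 in ['F_2], so one of them is nonzero, and on its cube every
    label takes both values. *)
Lemma cubical_sperner m N (a : 'I_m -> {ffun 'I_m -> nat} -> bool) :
  (forall k (v : {ffun 'I_m -> nat}), v k = 0%N -> a k v = false) ->
  (forall k (v : {ffun 'I_m -> nat}), v k = N -> a k v = true) ->
  exists v : {ffun 'I_m -> nat}, (forall k, (v k < N)%N) /\ forall i, exists p q,
    [/\ a i p != a i q, forall k, (v k <= p k <= (v k).+1)%N &
        forall k, (v k <= q k <= (v k).+1)%N].
Proof.
move=> a0 aN; pose b i (v : {ffun 'I_m -> nat}) : 'F_2 := (a i v)%:R.
have char2 : 2%N \in [pchar 'F_2] by rewrite pchar_Fp.
have b0 k (v : {ffun 'I_m -> nat}) : v k = 0%N -> b k v = 0 :> 'F_2.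
  by rewrite /b => /a0->.
have bN k (v : {ffun 'I_m -> nat}) : v k = N -> b k v = 1 by rewrite /b => /aN->.
pose z : {ffun 'I_m -> nat} := [ffun=> 0%N].
have := grid_sum_cup char2 b0 bN z (enum_uniq 'I_m) => /(congr1 (fun x => x != 0)).
rewrite oner_neq0 => /(grid_sum_neq0 (enum_uniq _))[v [nz vN _]].
exists v; split=> [k|i]; first by rewrite vN// mem_enum.
have [|p [q [pq hp hq]]] := cup_neq0 nz (i := i); first by rewrite mem_enum.
exists p, q; split=> [|k|k].
- by apply: contraNneq pq => e; rewrite /b e.
- by have := hp k; rewrite inE mem_enum addn1.
- by have := hq k; rewrite inE mem_enum addn1.
Qed.

(** * The Poincaré-Bohl theorem *)

Section EtaExpandedContinuity.
Variables (R : realType) (T : topologicalType).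

Lemma cont_comp (U V : topologicalType) (g : U -> V) (f : T -> U) :
  continuous g -> continuous f -> continuous (fun x => g (f x)).
Proof. by move=> cg cf x; exact: (continuous_comp (cf x) (cg (f x))). Qed.

Variable V : normedModType R.
Implicit Types (f g : T -> V) (s t : T -> R).

Lemma cont_add f g : continuous f -> continuous g ->
  continuous (fun x => f x + g x).
Proof. by move=> cf cg x; exact: (cvgD (cf x) (cg x)). Qed.

Lemma cont_sub f g : continuous f -> continuous g ->
  continuous (fun x => f x - g x).
Proof. by move=> cf cg x; exact: (cvgB (cf x) (cg x)). Qed.

Lemma cont_scale s f : continuous s -> continuous f ->
  continuous (fun x => s x *: f x).
Proof. by move=> cs cf x; exact: (cvgZ (cs x) (cf x)). Qed.

Lemma cont_norm f : continuous f -> continuous (fun x => `|f x|).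
Proof. by move=> cf x; exact: cvg_norm (cf x). Qed.

Lemma cont_mul s t : continuous s -> continuous t ->
  continuous (fun x => s x * t x).
Proof. by move=> cs ct x; exact: (cvgM (cs x) (ct x)). Qed.

Lemma cont_sqr s : continuous s -> continuous (fun x => s x ^+ 2).
Proof. by move=> cs; apply: cont_mul. Qed.

Lemma cont_inv s : continuous s -> (forall x, s x != 0) ->
  continuous (fun x => (s x)^-1).
Proof. by move=> cs s0 x; exact: (cvgV (s0 x) (cs x)). Qed.

Lemma cont_max s t : continuous s -> continuous t ->
  continuous (fun x => Num.max (s x) (t x)).
Proof. by move=> cs ct x; exact: continuous_max (cs x) (ct x). Qed.

Lemma cont_min s t : continuous s -> continuous t ->
  continuous (fun x => Num.min (s x) (t x)).
Proof. by move=> cs ct x; exact: continuous_min (cs x) (ct x). Qed.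

Lemma cont_sum (I : Type) (r : seq I) (P : pred I) (F : I -> T -> R) :
  (forall i, P i -> continuous (F i)) ->
  continuous (fun x => \sum_(i <- r | P i) F i x).
Proof.
move=> cF; elim: r => [|i r IHr].
  under eq_fun do rewrite big_nil.
  by move=> x; exact: cvg_cst.
under eq_fun do rewrite big_cons.
have [Pi|//] := boolP (P i); move=> x; exact: (cvgD (cF _ Pi x) (IHr x)).
Qed.

Lemma cont_row n (f : T -> 'rV[R]_n) :
  (forall j, continuous (fun x => f x ord0 j)) -> continuous f.
Proof.
move=> cf x; apply/cvgrPdist_le => e e0.
have : \forall y \near x, forall j, `|f x ord0 j - f y ord0 j| <= e.
  apply: filter_forall => j; have /cvgrPdist_le/(_ _ e0) := cf j x; exact.
apply: filterS => y H.
rewrite [leLHS]/Num.norm /= mx_normrE; apply/bigmax_leP; split=> [|[i j] _ /=].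
  exact: ltW.
by rewrite ord1 !mxE.
Qed.

End EtaExpandedContinuity.

Lemma cont_coord (R : realType) (T : topologicalType) n (f : T -> 'rV[R]_n) j :
  continuous f -> continuous (fun x => f x ord0 j).
Proof. exact: cont_comp (@coord_continuous _ _ _ _ _). Qed.

Lemma cont_sqrt (R : realType) (T : topologicalType) (s : T -> R) :
  continuous s -> continuous (fun x => Num.sqrt (s x)).
Proof. exact: cont_comp (@sqrt_continuous R). Qed.

Lemma cont_cst (T U : topologicalType) (c : U) : continuous (fun _ : T => c).
Proof. by move=> x; exact: cvg_cst. Qed.

Lemma cont_id (T : topologicalType) : continuous (fun x : T => x).
Proof. by move=> x; exact: cvg_id. Qed.

(** * The max norm, uniform continuity and compact cubes *)

Lemma coord_le_norm (R : realType) n (x : 'rV[R]_n) j : `|x ord0 j| <= `|x|.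
Proof.
by rewrite [leRHS]/Num.norm /= mx_normrE; apply/bigmax_geP; right; exists (ord0, j).
Qed.

Lemma norm_le_coord (R : realType) n (x : 'rV[R]_n) e : 0 <= e ->
  (forall j, `|x ord0 j| <= e) -> `|x| <= e.
Proof.
move=> e0 xe; rewrite [leLHS]/Num.norm /= mx_normrE; apply/bigmax_leP; split=> //.
by move=> [i j] _ /=; rewrite ord1.
Qed.

Lemma compact_unif_continuous (R : realType) (V W : normedModType R)
    (K : set V) (f : V -> W) (e : R) :
  compact K -> continuous f -> 0 < e ->
  exists2 d : R, 0 < d & forall x y, K x -> `|x - y| < d -> `|f x - f y| < e.
Proof.
move=> cK cf e0; have e20 : 0 < e / 2 by rewrite divr_gt0.
have /compact_near_coveringP nK := cK.
have := nK _ (0 : R)^'+ (fun d x => forall y, `|x - y| < d -> `|f x - f y| < e) _.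
case=> [|r /= r0 Hr].
  move=> x Kx; have /cvgrPdist_lt/(_ _ e20) := cf x.
  move=> /nbhs_ballP[r /= r0 Hr]; have r20 : 0 < r / 2 by rewrite divr_gt0.
  exists (ball x (r / 2), [set d : R | d < r / 2]).
    by split=> /=; [exact: nbhsx_ballx|exact: nbhs_right_lt].
  move=> [x' d] [/= + dr] y x'y; rewrite -ball_normE/= => xx'.
  have h1 : `|f x - f x'| < e / 2.
    by apply: Hr; rewrite -ball_normE/= (lt_trans xx')// ltr_pdivrMr// ltr_pMr// ltr1n.
  have h2 : `|f x - f y| < e / 2.
    apply: Hr; rewrite -ball_normE/=.
    by rewrite (le_lt_trans (ler_distD x' _ _))// [r]splitr ltrD// (lt_trans x'y).
  rewrite (le_lt_trans (ler_distD (f x) _ _))// [e]splitr ltrD// distrC//.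
have r20 : 0 < r / 2 by rewrite divr_gt0.
exists (r / 2) => // x y Kx xy.
apply: (Hr (r / 2)) => //=.
by rewrite sub0r normrN gtr0_norm// ltr_pdivrMr// ltr_pMr// ltr1n.
Qed.

Lemma compact_cube (R : realType) n (r : R) :
  compact [set x : 'rV[R]_n | `|x| <= r].
Proof.
apply: bounded_closed_compact.
  by exists r; split=> [|M rM x /= xr]; [exact: num_real|exact: le_trans xr (ltW rM)].
apply: (@closed_comp _ _ (fun x : 'rV[R]_n => `|x|) [set y : R | y <= r]).
  by move=> x _; exact: norm_continuous.
exact: closed_le.
Qed.

(** Without a zero, the norm of [G] would have a positive minimum on the cube. Labelling a fine grid
    by the signs of the coordinates of [G], a Sperner cube has a vertex where all coordinates are at
    most half that minimum. *)
Lemma poincare_miranda (R : realType) m (r : R) (G : 'rV[R]_m -> 'rV[R]_m) :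
  0 < r -> continuous G ->
  (forall (x : 'rV[R]_m) j, `|x| <= r -> x ord0 j = - r -> G x ord0 j <= 0) ->
  (forall (x : 'rV[R]_m) j, `|x| <= r -> x ord0 j = r -> 0 <= G x ord0 j) ->
  exists2 x, `|x| <= r & G x = 0.
Proof.
move=> r0 cG Gneg Gpos; apply: contrapT => noz.
have G0 x : `|x| <= r -> G x != 0.
  by move=> xr; apply/eqP => Gx; apply: noz; exists x.
have cC := @compact_cube R m r.
have C0 : [set x : 'rV[R]_m | `|x| <= r] !=set0 by exists 0; rewrite /= normr0 ltW.
have [|c /[!inE]/= cr cmin] := EVT_min_rV (f := fun x => `|G x|) C0 cC.
  by apply: continuous_subspaceT; exact: cont_norm.
have e0 : 0 < `|G c| / 2 by rewrite divr_gt0// normr_gt0 G0.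
have [d d0 Hd] := compact_unif_continuous cC cG e0.
pose N := (Num.truncn (2 * r / d)).+1.
have N0 : (0 : R) < N%:R by rewrite ltr0n.
have Nd : 2 * r / N%:R < d.
  rewrite ltr_pdivrMr// [d * _]mulrC -ltr_pdivrMr// /N.
  exact: truncnS_gt.
pose p (v : {ffun 'I_m -> nat}) : 'rV[R]_m := \row_j (- r + 2 * r / N%:R * (v j)%:R).
have pr (v : {ffun 'I_m -> nat}) : (forall k, (v k <= N)%N) -> `|p v| <= r.
  move=> vN; apply: norm_le_coord; [exact: ltW|] => j; rewrite mxE ler_norml.
  have h : (v j)%:R / N%:R <= 1 :> R by rewrite ler_pdivrMr// mul1r ler_nat.
  have h' : 0 <= (v j)%:R / N%:R :> R by rewrite divr_ge0.
  by rewrite mulrAC -mulrA; set t := _ / _ in h h' *; apply/andP; split; nra.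
(* The label is forced on the sides of the grid; there [Gneg] and [Gpos] guarantee the matching weak
   sign, which is all that [avals] records. *)
pose a j (v : {ffun 'I_m -> nat}) : bool :=
  if v j == 0 then false else if v j == N then true else 0 < G (p v) ord0 j.
have [||v [vN Hv]] := @cubical_sperner m N a.
- by move=> k w w0; rewrite /a w0 eqxx.
- by move=> k w wN; rewrite /a wN eqxx.
have avals j (w : {ffun 'I_m -> nat}) : (forall k, (w k <= N)%N) ->
    if a j w then 0 <= G (p w) ord0 j else G (p w) ord0 j <= 0.
  move=> wN; rewrite /a; case: eqP => [w0|_].
    by apply: Gneg; [exact: pr|rewrite mxE w0 mulr0 addr0].
  case: eqP => [wjN|_]; last by case: ltP => // /ltW.
  apply: Gpos; first exact: pr.
  by rewrite mxE wjN divfK ?gt_eqF//; lra.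
have close (w : {ffun 'I_m -> nat}) : (forall k, (v k <= w k <= (v k).+1)%N) ->
    (forall k, (w k <= N)%N) /\ `|p v - p w| < d.
  move=> vw; split=> [k|]; first by have /andP[_ h] := vw k; exact: leq_trans h (vN k).
  apply: le_lt_trans Nd; apply: norm_le_coord => [|j].
    by rewrite divr_ge0 ?mulr_ge0 ?ltW.
  rewrite !mxE opprD addrACA subrr add0r -mulrBr normrM ger0_norm; last first.
    by rewrite divr_ge0 ?mulr_ge0 ?ltW.
  rewrite ler_piMr ?divr_ge0 ?mulr_ge0 ?(ltW r0)//.
  have /andP[h1 h2] := vw j; rewrite distrC -natrB// normr_nat -[1]/(1%:R) ler_nat.
  by rewrite leq_subLR addn1.
have vr : `|p v| <= r by apply: pr => k; exact: ltnW.
have := cmin (p v); rewrite inE => /(_ vr); apply/negP; rewrite -ltNge.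
apply: (@le_lt_trans _ _ (`|G c| / 2)); last first.
  by rewrite ltr_pdivrMr// ltr_pMr ?ltr1n// normr_gt0 G0.
apply: norm_le_coord => [|j]; first exact: ltW.
have near (w : {ffun 'I_m -> nat}) : (forall k, (v k <= w k <= (v k).+1)%N) ->
    `|G (p v) ord0 j - G (p w) ord0 j| <= `|G c| / 2.
  move=> /close[_ /(Hd _ _ vr)/ltW]; apply: le_trans.
  by have := coord_le_norm (G (p v) - G (p w)) j; rewrite !mxE.
(* Coordinate [j] of [G] has opposite weak signs at two vertices of the cube, and both values are
   within half the minimum of the one at [p v]. *)
have [x [y [axy hx hy]]] := Hv j.
have := near _ hx; have := near _ hy; have := avals j _ (close _ hx).1.
have := avals j _ (close _ hy).1; move: axy; rewrite !ler_norml.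
case: (a j x); case: (a j y) => //= _ ? ? /andP[? ?] /andP[? ?].
all: by apply/andP; split; lra.
Qed.

Lemma cube_retraction (R : realType) m : exists rho : 'rV[R]_m -> 'rV[R]_m,
  [/\ continuous rho, forall x, `|rho x| <= 1, forall x, `|x| <= 1 -> rho x = x &
      forall x, 1 <= `|x| -> rho x = `|x|^-1 *: x].
Proof.
have max0 (x : 'rV[R]_m) : 0 < Num.max 1 `|x| by rewrite lt_max ltr01.
exists (fun x => (Num.max 1 `|x|)^-1 *: x); split=> [|x|x x1|x x1].
- apply: cont_scale; last exact: cont_id.
  apply: cont_inv => [|x]; last by rewrite gt_eqF.
  by apply: cont_max; [exact: cont_cst|exact: norm_continuous].
- by rewrite normrZ normfV gtr0_norm// mulrC ler_pdivrMr// mul1r le_max lexx orbT.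
- by rewrite (max_idPl _)// invr1 scale1r.
- by rewrite (max_idPr _).
Qed.

(** With [M] a bound of [G], the extension [G (rho x) + M (x - rho x)] to the cube of radius 2
    satisfies the sign conditions of Poincaré-Miranda: on the sides the added term is [M] or [-M]. A
    zero in the unit cube is a zero of [G]; a zero outside gives the second alternative at
    [rho x]. *)
Lemma poincare_bohl (R : realType) m (G : 'rV[R]_m -> 'rV[R]_m) :
  continuous G ->
  exists x, (`|x| <= 1 /\ G x = 0) \/
    (`|x| = 1 /\ exists2 c, 0 <= c & G x = - c *: x).
Proof.
move=> cG; have cC := @compact_cube R m 1.
have C0 : [set x : 'rV[R]_m | `|x| <= 1] !=set0 by exists 0; rewrite /= normr0.
have [|b _ bmax] := EVT_max_rV (f := fun x => `|G x|) C0 cC.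
  by apply: continuous_subspaceT; exact: cont_norm.
have M0 : 0 <= `|G b| by exact: normr_ge0.
set M := `|G b| in M0 bmax.
have [rho [crho rho1 rho_in rho_out]] := cube_retraction R m.
have GM x j : `|G (rho x) ord0 j| <= M.
  by apply: le_trans (coord_le_norm _ _) _; apply: bmax; rewrite inE /=.
pose G' x := G (rho x) + M *: (x - rho x).
have cG' : continuous G'.
  apply: cont_add; first exact: cont_comp cG crho.
  by apply: cont_scale; [exact: cont_cst|apply: cont_sub; [exact: cont_id|exact: crho]].
have G'E (x : 'rV[R]_m) j : `|x| <= 2 -> `|x ord0 j| = 2 ->
    G' x ord0 j = G (rho x) ord0 j + M * (x ord0 j - 2^-1 * x ord0 j).
  move=> xle xj; have x2 : `|x| = 2 by apply/le_anti; rewrite xle -xj coord_le_norm.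
  have e : rho x = 2^-1 *: x by rewrite rho_out x2// ler1n.
  by rewrite /G' [X in x - X]e !mxE.
have [|||x x2 G'x] := @poincare_miranda R m 2 G' _ cG' => //.
- move=> x j x2 xj; rewrite G'E// xj ?normrN ?normr_nat//.
  by have := GM x j; rewrite ler_norml => /andP[_ h]; lra.
- move=> x j x2 xj; rewrite G'E// xj ?normr_nat//.
  by have := GM x j; rewrite ler_norml => /andP[h _]; lra.
have [x1|x1] := leP `|x| 1.
  exists x; left; split=> //; move: G'x; rewrite /G' rho_in//.
  by rewrite subrr scaler0 addr0.
have x0 : `|x| != 0 by rewrite gt_eqF// (lt_trans ltr01).
have rhoE : rho x = `|x|^-1 *: x by rewrite rho_out// ltW.
exists (rho x); right; split.
  by rewrite rhoE normrZ normfV normr_id mulVf.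
exists (M * (`|x| - 1)); first by rewrite mulr_ge0// subr_ge0 ltW.
have xE : x = `|x| *: rho x by rewrite rhoE scalerA mulfV// scale1r.
move/eqP: G'x; rewrite addr_eq0 => /eqP->; rewrite {1}xE.
by rewrite -[X in _ - X]scale1r -scalerBl scalerA scaleNr.
Qed.

(** * Continuous square roots *)

(** The bisector [s + i r] of [p + i r] and the positive axis squares to [2 s (p + i r)]; this is
    the real part of that identity. *)
Lemma half_angle (R : rcfType) (p r : R) :
  let s := Num.sqrt (p ^+ 2 + r ^+ 2) + p in s ^+ 2 - r ^+ 2 = 2 * s * p.
Proof.
have q0 : 0 <= p ^+ 2 + r ^+ 2 by rewrite addr_ge0 ?sqr_ge0.
by rewrite /= sqrrD sqr_sqrtr//; ring.
Qed.

Lemma exists_square_root (R : rcfType) (a b : R) : (a, b) != (0, 0) ->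
  exists g h c : R, [/\ 0 < c, g ^+ 2 - h ^+ 2 = c * a & 2 * g * h = c * b].
Proof.
move=> ab0; have := half_angle a b; set s := _ + a => /= e.
have [s0|s0] := ltP 0 s; first by exists s, b, (2 * s); rewrite mulr_gt0.
(* Otherwise [a + i b] is a negative real number, and [i] is a root up to a positive factor. *)
have q0 : 0 <= a ^+ 2 + b ^+ 2 by rewrite addr_ge0 ?sqr_ge0.
have M0 := sqrtr_ge0 (a ^+ 2 + b ^+ 2); have M2 := sqr_sqrtr q0.
have b0 : b = 0.
  apply/eqP; rewrite -sqrf_eq0 eq_le sqr_ge0 andbT.
  by move: M0 M2 s0; rewrite /s; nra.
have a0 : a < 0.
  rewrite lt_neqAle; apply/andP; split; last by rewrite /s in s0; lra.
  by apply: contraNneq ab0 => ->; rewrite b0.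
exists 0, 1, (- a^-1); rewrite b0 !mulr0 mul0r oppr_gt0 invr_lt0; split=> //.
by rewrite mulNr mulVf ?lt_eqF// expr0n expr1n sub0r.
Qed.

(* The root is the product, over a fine subdivision of the segment from 0 to x,
   of principal roots of the quotients of consecutive values of (a, b). *)
Lemma continuous_square_root (R : realType) d (a b : 'rV[R]_d -> R) :
  continuous a -> continuous b -> (forall x, (a x, b x) != (0, 0)) ->
  exists g h : 'rV[R]_d -> R, [/\ continuous g, continuous h &
    forall x, `|x| <= 1 -> exists c, [/\ 0 < c,
      g x ^+ 2 - h x ^+ 2 = c * a x & 2 * g x * h x = c * b x]].
Proof.
move=> ca cb ab0; have cC := @compact_cube R d 1.
have C0 : [set x : 'rV[R]_d | `|x| <= 1] !=set0 by exists 0; rewrite /= normr0.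
pose q x := a x ^+ 2 + b x ^+ 2.
have cq : continuous q by apply: cont_add; exact: cont_sqr.
have q0 x : 0 < q x.
  rewrite lt_neqAle addr_ge0 ?sqr_ge0// andbT eq_sym paddr_eq0 ?sqr_ge0// !sqrf_eq0.
  exact: ab0.
have [|m _ mmin] := EVT_min_rV (f := q) C0 cC; first exact: continuous_subspaceT.
(* If [a] and [b] each vary by less than [e], then [a + i b] moves by less than its own modulus, so
   the quotient of the two values has positive real part. *)
pose e := Num.sqrt (q m / 2).
have e0 : 0 < e by rewrite sqrtr_gt0 divr_gt0.
have e2 : e ^+ 2 = q m / 2 by rewrite sqr_sqrtr ?divr_ge0 ?ltW.
have [d1 d10 Hd1] := compact_unif_continuous cC ca e0.
have [d2 d20 Hd2] := compact_unif_continuous cC cb e0.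
pose del := Num.min d1 d2; have del0 : 0 < del by rewrite lt_min d10.
pose N := (Num.truncn del^-1).+1.
have N0 : (0 : R) < N%:R by rewrite ltr0n.
have Nd : N%:R^-1 < del by rewrite invf_plt ?posrE//; exact: truncnS_gt.
pose y (n : nat) (x : 'rV[R]_d) : 'rV[R]_d := (n%:R / N%:R) *: x.
have cy n : continuous (y n) by apply: cont_scale; [exact: cont_cst|exact: cont_id].
have step n x : (n < N)%N -> `|x| <= 1 ->
    0 < a (y n.+1 x) * a (y n x) + b (y n.+1 x) * b (y n x).
  move=> nN x1; have xn : `|y n x| <= 1.
    rewrite normrZ ger0_norm ?divr_ge0// mulr_ile1 ?divr_ge0//.
    by rewrite ler_pdivrMr// mul1r ler_nat ltnW.
  have close : `|y n x - y n.+1 x| < del.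
    apply: le_lt_trans Nd; rewrite -scalerBl -mulrBl normrZ normrM distrC.
    rewrite -natrB// subSnn.
    by rewrite normr1 mul1r normfV gtr0_norm// ler_piMr// invr_ge0 ltW.
  move: (close); rewrite lt_min => /andP[/(Hd1 _ _ xn) + /(Hd2 _ _ xn)].
  have := mmin (y n x); rewrite inE => /(_ xn); rewrite /q in e2 *.
  move: (a (y n x)) (b (y n x)) (a (y n.+1 x)) (b (y n.+1 x)) => u v u' v'.
  move=> hq; rewrite !ltr_norml => /andP[h1 h2] /andP[h3 h4].
  have k1 : (u - u') ^+ 2 < e ^+ 2 by nra.
  have k2 : (v - v') ^+ 2 < e ^+ 2 by nra.
  have : (u - u') ^+ 2 + (v - v') ^+ 2 < u ^+ 2 + v ^+ 2 by lra.
  by nra.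
suff H n : (n <= N)%N -> exists g h : 'rV[R]_d -> R,
    [/\ continuous g, continuous h &
    forall x, `|x| <= 1 -> exists c, [/\ 0 < c,
      g x ^+ 2 - h x ^+ 2 = c * a (y n x) & 2 * g x * h x = c * b (y n x)]].
  have [g [h [cg ch H1]]] := H N (leqnn N); exists g, h; split=> // x /H1.
  by rewrite /y divff ?gt_eqF// scale1r.
elim: n => [_|n IHn nN].
  have [g [h [c H1]]] := exists_square_root (ab0 0).
  exists (fun=> g), (fun=> h); split; [exact: cont_cst|exact: cont_cst|move=> x _].
  by exists c; rewrite /y mul0r scale0r.
have [g [h [cg ch H1]]] := IHn (ltnW nN).
(* [p + i r] is the new value of [a + i b] times the conjugate of the old one. The old root
   [g + i h] gets multiplied by its bisector [s + i r], where [s] is positive by [step]. *)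
pose p x := a (y n.+1 x) * a (y n x) + b (y n.+1 x) * b (y n x).
pose r x := b (y n.+1 x) * a (y n x) - a (y n.+1 x) * b (y n x).
have cay k : continuous (fun x => a (y k x)) by exact: cont_comp ca (cy k).
have cby k : continuous (fun x => b (y k x)) by exact: cont_comp cb (cy k).
have cp : continuous p by apply: cont_add; exact: cont_mul.
have cr : continuous r by apply: cont_sub; exact: cont_mul.
pose s x := Num.sqrt (p x ^+ 2 + r x ^+ 2) + p x.
have cs : continuous s.
  by apply: cont_add => //; apply: cont_sqrt; apply: cont_add; exact: cont_sqr.
exists (fun x => g x * s x - h x * r x), (fun x => g x * r x + h x * s x).
split; [by apply: cont_sub; exact: cont_mul|by apply: cont_add; exact: cont_mul|].
move=> x x1; have [c [c0 e1 e3]] := H1 x x1.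
have s0 : 0 < s x by rewrite ltr_wpDl ?sqrtr_ge0//; exact: step.
have := half_angle (p x) (r x); rewrite /= -/(s x) => e4.
exists (c * (2 * s x) * q (y n x)); split.
- by rewrite !mulr_gt0.
- transitivity ((g x ^+ 2 - h x ^+ 2) * (s x ^+ 2 - r x ^+ 2) -
    (2 * g x * h x) * (2 * s x * r x)); first by ring.
  by rewrite e1 e3 e4 /p /r /q; ring.
- transitivity ((g x ^+ 2 - h x ^+ 2) * (2 * s x * r x) +
    (2 * g x * h x) * (s x ^+ 2 - r x ^+ 2)); first by ring.
  by rewrite e1 e3 e4 /p /r /q; ring.
Qed.

(** * Balls as images of disks *)

Definition set_elt (T : Type) (A : set T) (x : T) (Ax : A x) : set_type A :=
  exist _ x (mem_set Ax).

Lemma cont_set_val (T : topologicalType) (A : set T) :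
  continuous (set_val : set_type A -> T).
Proof. exact: initial_continuous. Qed.

Lemma cont_to_set_type (T U : topologicalType) (A : set U) (f : T -> set_type A) :
  continuous (fun x => set_val (f x)) -> continuous f.
Proof. exact: continuous_comp_initial. Qed.

Lemma disk_retraction (R : realType) d : exists rho : 'rV[R]_d -> 'rV[R]_d,
  [/\ continuous rho, forall x, unit_disk (rho x) &
      forall x, unit_disk x -> rho x = x].
Proof.
pose q (x : 'rV[R]_d) := \sum_j x ord0 j ^+ 2.
have q0 x : 0 <= q x by apply: sumr_ge0 => j _; exact: sqr_ge0.
have cq : continuous q.
  by apply: cont_sum => j _; apply: cont_sqr; apply: cont_coord; exact: cont_id.
have max0 x : 0 < Num.max 1 (Num.sqrt (q x)) by rewrite lt_max ltr01.
have sq x : Num.sqrt (q x) ^+ 2 = q x by exact: sqr_sqrtr.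
exists (fun x => (Num.max 1 (Num.sqrt (q x)))^-1 *: x); split=> [|x|x x1].
- apply: cont_scale; last exact: cont_id.
  apply: cont_inv => [|x]; last by rewrite gt_eqF.
  by apply: cont_max; [exact: cont_cst|exact: cont_sqrt].
- rewrite /unit_disk /=; under eq_bigr do rewrite mxE exprMn.
  rewrite -mulr_sumr -/(q x) exprVn mulrC ler_pdivrMr ?exprn_gt0// mul1r -[leLHS]sq.
  by rewrite lerXn2r ?nnegrE ?sqrtr_ge0 ?(ltW (max0 x))// le_max lexx orbT.
- by rewrite (max_idPl _) ?invr1 ?scale1r// -sqrtr1 ler_sqrt.
Qed.

Lemma unit_disk_norm (R : realType) d (x : 'rV[R]_d) : unit_disk x -> `|x| <= 1.
Proof.
move=> x1; apply: norm_le_coord => // j.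
rewrite -(ler_sqr (x := `|_|)) ?nnegrE// expr1n real_normK ?num_real//.
apply: le_trans x1; rewrite (bigD1 j)//= lerDl.
by apply: sumr_ge0 => k _; exact: sqr_ge0.
Qed.

(** Replaces the homeomorphism between subspaces by total maps: [H] is precomposed with a retraction
    onto the disk, and [J] inverts it on [K]. *)
Lemma bounds_ball_parametrization (R : realType) n (K B : set 'rV[R]_n) :
  bounds_ball K B -> exists d (H : 'rV[R]_d -> 'rV[R]_n) (J : 'rV[R]_n -> 'rV[R]_d),
  [/\ continuous H, forall x, B (H x), {within K, continuous J} &
      forall p, K p -> `|J p| <= 1 /\ H (J p) = p].
Proof.
move=> [k [h [[ch [hi [chi hK hiK]]] bK]]].
have [rho [crho rhoD rho_id]] := disk_retraction R k.+1.
pose H x := set_val (h (set_elt (rhoD x))).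
have KB p : K p -> B p by rewrite -bK => -[x _ <-]; exact: set_valP.
(* The value 0 off [B] is arbitrary, which is why continuity of [J] is only claimed within [K]. *)
pose J p : 'rV[R]_k.+1 :=
  if pselect (B p) is left Bp then set_val (hi (set_elt Bp)) else 0.
have JE p (Bp : B p) : J p = set_val (hi (set_elt Bp)).
  rewrite /J; case: pselect => // Bp'; congr (set_val (hi _)); exact: val_inj.
exists k.+1, H, J; split=> [|x||p /KB Bp].
- apply: cont_comp; first exact: cont_set_val.
  by apply: cont_comp; [exact: ch|exact: cont_to_set_type].
- exact: set_valP.
- apply/subspace_sigL_continuousP.
  have -> : sigL K J = fun x => set_val (hi (set_elt (KB _ (set_valP x)))).
    by apply/funext => x; exact: JE.
  apply: cont_comp; first exact: cont_set_val.
  apply: cont_comp; first exact: chi.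
  by apply: cont_to_set_type; exact: cont_set_val.
- rewrite JE; have D := set_valP (hi (set_elt Bp)).
  split; first exact: unit_disk_norm.
  rewrite /H (_ : set_elt (rhoD _) = hi (set_elt Bp)) ?hiK//.
  by apply: val_inj; rewrite /= rho_id.
Qed.

Lemma cont_at_within (T U V : topologicalType) (K : set U) (J : U -> V)
    (f : T -> U) t :
  {within K, continuous J} -> {for t, continuous f} ->
  (\forall s \near t, K (f s)) ->
  {for t, continuous (fun s => J (f s))}.
Proof.
move=> /subspace_continuousP cJ cf Kf.
have Kt : K (f t) by exact: nbhs_singleton Kf.
move=> A /(cJ _ Kt) /=; rewrite /within /= => /cf /= fA.
by apply: filterS2 Kf fA => s /= Ks; apply.
Qed.

(** [X] may be discontinuous at the origin, but it is bounded elsewhere and the factor tends to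
    0. *)
Lemma cont_cone (R : realType) m (V : normedModType R) (X : 'rV[R]_m -> V) :
  (forall y, y != 0 -> {for y, continuous X}) ->
  (forall y, y != 0 -> `|X y| <= 1) ->
  continuous (fun y => `|y| *: X y).
Proof.
move=> cX X1 y; have [y0|y0] := eqVneq y 0; last first.
  by apply: continuousZ; [exact: norm_continuous|exact: (cX _ y0)].
apply/(@cvgrPdist_le _ _ _ (nbhs y) (nbhs_filter y)) => e e0.
have /cvgrPdist_le/(_ _ e0) := @norm_continuous R 'rV[R]_m y.
apply: filterS => z; rewrite y0 normr0 scale0r !sub0r !normrN.
rewrite normr_id normrZ normr_id.
apply: le_trans; have [->|z0] := eqVneq z 0; first by rewrite normr0 mul0r.
by rewrite ler_piMr// X1.
Qed.

(** * K3 does not bound a ball disjoint from K1 and K2 *)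

Lemma coord1S (R : realType) n (x : 'rV[R]_n) k (kn : (k < n)%N) :
  coord1 x k.+1 = x ord0 (Ordinal kn).
Proof. by rewrite /coord1 /= insubT. Qed.

Lemma coord1_row (R : realType) n (f : nat -> R) k : (k < n)%N ->
  coord1 (\row_(l < n) f l) k.+1 = f k.
Proof. by move=> kn; rewrite coord1S mxE. Qed.

Lemma coord1_scale (R : realType) n (c : R) (x : 'rV[R]_n) k :
  coord1 (c *: x) k = c * coord1 x k.
Proof. by rewrite /coord1; case: insub => [j|]; rewrite ?mxE ?mulr0. Qed.

Lemma cont_coord1 (R : realType) (T : topologicalType) n k (f : T -> 'rV[R]_n) :
  continuous f -> continuous (fun x => coord1 (f x) k).
Proof.
by rewrite /coord1; case: insub => [j|] cf; [exact: cont_coord|exact: cont_cst].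
Qed.

Lemma row_coord1P (R : realType) n (x y : 'rV[R]_n) :
  (forall k, (k < n)%N -> coord1 x k.+1 = coord1 y k.+1) -> x = y.
Proof.
move=> xy; apply/rowP => j; have := xy j (ltn_ord j).
by rewrite !coord1S; rewrite (_ : Ordinal _ = j)//; exact: val_inj.
Qed.

Lemma sum_sqr_eq0 (R : realType) a b (f : nat -> R) :
  \sum_(a <= j < b) f j ^+ 2 = 0 -> forall j, (a <= j < b)%N -> f j = 0.
Proof.
move=> /eqP; rewrite psumr_eq0 => [/allP h j jab|j _]; last exact: sqr_ge0.
apply/eqP; rewrite -sqrf_eq0; apply: (implyP (h j _)) => //.
by rewrite mem_index_iota.
Qed.

(** Since [h] is positive, [g] has the sign of [s], and so has the minimum. It is applied at the
    poles of [K3], where [7 = 16 - 9] is the value of [|x|^2 - 9] and [r (4 s)] that of [t]. *)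
Lemma min_sign_contra (R : realFieldType) (s g h r c c' : R) : s = 1 \/ s = -1 ->
  0 < h -> 0 < r -> 0 <= c -> 0 < c' -> 2 * g * h = c' * (r * (4 * s)) ->
  Num.min 7 g != - c * s.
Proof.
move=> s1 h0 r0 c0 c'0 e; apply/eqP; have cr : 0 < c' * r by rewrite mulr_gt0.
have [g0|g0] := ltP 0 g.
  have gh : 0 < g * h by rewrite mulr_gt0.
  case: s1 e => -> e; last by lra.
  by rewrite minElt; case: ifP => _; lra.
have gh : g * h <= 0 by rewrite mulr_le0_ge0// ltW.
case: s1 e => -> e; first by lra.
have gn : g < 0.
  by rewrite lt_neqAle g0 andbT; apply/eqP => gE; rewrite gE in e; lra.
by rewrite min_r; lra.
Qed.

Section Obstruction.
Variables (R : realType) (n i : nat).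
Hypotheses (i_gt0 : (0 < i)%N) (i_lt : (i < n.-1)%N).

Let n_gt0 : (0 < n)%N. Proof. by case: n i_lt. Qed.

Let i1n : (i.+1 < n)%N. Proof. by rewrite -ltn_predRL. Qed.

Definition usq (x : 'rV[R]_n) := \sum_(1 <= j < i.+1) coord1 x j ^+ 2.
Definition vsq (x : 'rV[R]_n) := \sum_(i.+1 <= j < n) coord1 x j ^+ 2.

Lemma K1E x : K1 R n x <-> usq x + vsq x = 4 /\ coord1 x n = 0.
Proof.
by rewrite /K1 /= (big_cat_nat (n := i.+1)) //= ltnW.
Qed.

Lemma K2E x : K2 R n i x <-> vsq x + coord1 x n ^+ 2 = 9 /\ usq x = 0.
Proof.
rewrite /K2 /= big_nat_recr /=; last exact: ltnW.
split=> -[-> h]; split=> //; last exact: sum_sqr_eq0 h.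
by apply: big1_seq => j /=; rewrite mem_index_iota => /h->; rewrite expr0n.
Qed.

Lemma K3E x : K3 R n i x <-> usq x + coord1 x n ^+ 2 / 16 = 1 /\ vsq x = 0.
Proof.
rewrite /K3 /=; split=> -[-> h]; split=> //.
  apply: big1_seq => j /=; rewrite mem_index_iota => /andP[h1 h2].
  by rewrite h ?expr0n// h1 -ltnS prednK.
by move=> j /andP[h1 h2]; apply: (sum_sqr_eq0 h); rewrite h1 -(prednK n_gt0) ltnS.
Qed.

Lemma cont_usq (T : topologicalType) (f : T -> 'rV[R]_n) :
  continuous f -> continuous (fun x => usq (f x)).
Proof.
by move=> cf; apply: cont_sum => j _; apply: cont_sqr; exact: cont_coord1.
Qed.

Lemma cont_vsq (T : topologicalType) (f : T -> 'rV[R]_n) :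
  continuous f -> continuous (fun x => vsq (f x)).
Proof.
by move=> cf; apply: cont_sum => j _; apply: cont_sqr; exact: cont_coord1.
Qed.

Let eucl (y : 'rV[R]_i.+1) := Num.sqrt (\sum_(1 <= j < i.+2) coord1 y j ^+ 2).

Let eucl_gt0 y : y != 0 -> 0 < eucl y.
Proof.
move=> y0; rewrite sqrtr_gt0 lt_neqAle.
rewrite sumr_ge0 ?andbT => [|j _]; last exact: sqr_ge0.
apply: contraNneq y0 => /esym/sum_sqr_eq0 h; apply/eqP/row_coord1P => k ki.
by rewrite h// -(scale0r (0 : 'rV[R]__)) coord1_scale mul0r.
Qed.

(** The linear map [(u, t) -> (u, 0, 4 t)], 4 being the long half-axis of [K3]. Here [l] counts from
    0, so the last coordinate has index [n.-1]. *)
Let lin (y : 'rV[R]_i.+1) (l : nat) : R :=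
  if (l < i)%N then coord1 y l.+1 else if l == n.-1 then 4 * coord1 y i.+1 else 0.

(** Dividing by the Euclidean norm lets every nonzero [y] parametrize a point of [K3], as suits the
    max-norm cube of Poincaré-Bohl. *)
Definition ellipsoid_param (y : 'rV[R]_i.+1) : 'rV[R]_n :=
  (eucl y)^-1 *: \row_(l < n) lin y l.

Lemma coord1_param y k : (k < n)%N ->
  coord1 (ellipsoid_param y) k.+1 = (eucl y)^-1 * lin y k.
Proof. by move=> kn; rewrite coord1_scale coord1_row. Qed.

Let coord1_param_u y k : (k < i)%N ->
  coord1 (ellipsoid_param y) k.+1 = (eucl y)^-1 * coord1 y k.+1.
Proof.
move=> ki; rewrite coord1_param ?/lin ?ki//.
by rewrite (ltn_trans ki)// ltnW.
Qed.

Let coord1_param_t y :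
  coord1 (ellipsoid_param y) n = (eucl y)^-1 * (4 * coord1 y i.+1).
Proof.
rewrite -[X in coord1 _ X](prednK n_gt0) coord1_param ?prednK// /lin.
by rewrite eqxx ltnNge ltnW.
Qed.

Lemma ellipsoid_paramK3 y : y != 0 -> K3 R n i (ellipsoid_param y).
Proof.
move=> y0; apply/K3E; have e0 := eucl_gt0 y0; split.
  have -> : usq (ellipsoid_param y) =
      (eucl y)^-1 ^+ 2 * (\sum_(1 <= j < i.+1) coord1 y j ^+ 2).
    rewrite mulr_sumr; apply: eq_big_nat => -[|j] // /andP[_ ji].
    by rewrite coord1_param_u// exprMn.
  have /sqr_sqrtr : 0 <= \sum_(1 <= j < i.+2) coord1 y j ^+ 2.
    by apply: sumr_ge0 => j _; exact: sqr_ge0.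
  rewrite -/(eucl y) big_nat_recr//= coord1_param_t => e2.
  have -> : ((eucl y)^-1 * (4 * coord1 y i.+1)) ^+ 2 / 16 =
      (eucl y)^-1 ^+ 2 * coord1 y i.+1 ^+ 2.
    by rewrite !exprMn; lra.
  by rewrite -mulrDr -e2 -exprMn mulVf ?expr1n// gt_eqF.
apply: big1_seq => -[|j] /=; rewrite mem_index_iota// => /andP[ij jn].
rewrite coord1_param ?(ltn_trans _ jn)// /lin.
by rewrite ltnNge -ltnS ij /= ltn_eqF ?mulr0 ?expr0n// ltn_predRL.
Qed.

Lemma cont_ellipsoid_param y : y != 0 -> {for y, continuous ellipsoid_param}.
Proof.
move=> y0.
apply: (@continuousZ R _ _ (fun y => (eucl y)^-1)
  (fun y => \row_(l < n) lin y l)).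
  apply: continuousV; first by rewrite gt_eqF ?eucl_gt0.
  clear y0; move: y; apply: cont_sqrt; apply: cont_sum => j _; apply: cont_sqr.
  by apply: cont_coord1; exact: cont_id.
clear y0; move: y; apply: cont_row => j; under eq_fun do rewrite mxE /lin.
have ct k := @cont_coord1 R 'rV[R]_i.+1 _ k _ (@cont_id _).
have [_|_] := boolP (j < i)%N; first exact: ct.
have [_|_] := boolP (j == n.-1 :> nat); last exact: cont_cst.
by apply: cont_mul; [exact: cont_cst|exact: ct].
Qed.

Lemma K3_not_bounding (B : set 'rV[R]_n) : bounds_ball (K3 R n i) B ->
  B `&` K1 R n = set0 -> B `&` K2 R n i = set0 -> False.
Proof.
move=> bB BK1 BK2.
have [d [H [J [cH HB cJ JK]]]] := bounds_ball_parametrization bB.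
have notK1 x : ~ K1 R n (H x).
  by move=> h; have : (B `&` K1 R n) (H x) by []; rewrite BK1.
have notK2 x : ~ K2 R n i (H x).
  by move=> h; have : (B `&` K2 R n i) (H x) by []; rewrite BK2.
have ctn : continuous (fun x => coord1 (H x) n) by exact: cont_coord1.
pose sq x := usq (H x) + vsq (H x) + coord1 (H x) n ^+ 2.
have csq : continuous sq.
  apply: cont_add; last exact: cont_sqr.
  by apply: cont_add; [exact: cont_usq|exact: cont_vsq].
pose a x := sq x - 4.
have ca : continuous a by apply: cont_sub; [exact: csq|exact: cont_cst].
have ab0 x : (a x, coord1 (H x) n) != (0, 0).
  apply/eqP => -[/eqP]; rewrite subr_eq0 /sq => /eqP e e0.
  by apply: (notK1 x); apply/K1E; rewrite -e e0 expr0n addr0.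
pose X y := J (ellipsoid_param y).
have KX y : y != 0 -> `|X y| <= 1 /\ H (X y) = ellipsoid_param y.
  by move=> /ellipsoid_paramK3/JK.
have cX y : y != 0 -> {for y, continuous X}.
  move=> y0; apply: (cont_at_within cJ); first exact: cont_ellipsoid_param.
  have : nbhs y (~` [set 0 : 'rV[R]_i.+1]).
    apply: open_nbhs_nbhs; split; last exact/eqP.
    rewrite openC.
    exact/accessible_closed_set1/hausdorff_accessible/norm_hausdorff.
  by apply: filterS => z /= /eqP/ellipsoid_paramK3.
pose pole (s : R) : 'rV[R]_i.+1 := \row_k (if k == ord_max then s else 0).
pose root_of (g h : 'rV[R]_d -> R) := forall x, `|x| <= 1 -> exists c, [/\ 0 < c,
  g x ^+ 2 - h x ^+ 2 = c * a x & 2 * g x * h x = c * coord1 (H x) n].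
(* If the imaginary part of the root vanished, then [t = 0] and [|x|^2 >= 4], whereas points of [K3]
   with [t = 0] have [|x|^2 = 1]. *)
have h_neq0 g h y : root_of g h -> y != 0 -> h (X y) != 0.
  move=> rt y0; have [X1 HX] := KX y y0; have [c [c0 e1 e2]] := rt _ X1.
  apply/eqP => hX; have := ellipsoid_paramK3 y0; rewrite -HX => /K3E[k1 k2].
  move: e1 e2; rewrite /a /sq hX k2 mulr0 => e1 /esym/eqP.
  rewrite mulf_eq0 gt_eqF//= => /eqP t0; rewrite t0 in e1 k1.
  have u1 : usq (H (X y)) = 1 by lra.
  by have := sqr_ge0 (g (X y)); rewrite u1 in e1; nra.
have [g [h [cg ch rt hpole]]] : exists g h, [/\ continuous g, continuous h,
    root_of g h & forall s, s = 1 \/ s = -1 -> 0 < h (X (pole s))].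
  have [g [h [cg ch rt]]] := continuous_square_root ca ctn ab0.
  (* A path of nonzero vectors joining the two poles; its first and last entries are distinct
     because [i > 0]. By the intermediate value theorem [h] has the same sign at both ends. *)
  pose path (s : R) : 'rV[R]_i.+1 :=
    \row_k (if k == ord_max then s else if k == ord0 then 1 - s ^+ 2 else 0).
  have path0 s : path s != 0.
    apply/eqP => /rowP e; have := e ord_max; rewrite !mxE eqxx => s0.
    have := e ord0; rewrite !mxE eqxx -val_eqE /= ltn_eqF// s0 expr0n subr0.
    by move/eqP; rewrite oner_eq0.
  have pathE s : s = 1 \/ s = -1 -> path s = pole s.
    move=> s1; apply/rowP => k; rewrite !mxE; case: ifP => // _.
    by case: s1 => ->; rewrite ?sqrrN expr1n subrr if_same.
  have cpath : continuous path.
    apply: cont_row => k; under eq_fun do rewrite mxE.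
    have [_|_] := eqVneq k ord_max; first exact: cont_id.
    have [_|_] := eqVneq k ord0; last exact: cont_cst.
    by apply: cont_sub; [exact: cont_cst|apply: cont_sqr; exact: cont_id].
  pose f s := h (X (path s)).
  have f0 s : f s != 0 by exact: (h_neq0 g h _ rt (path0 s)).
  have cf : continuous f.
    apply: cont_comp; first exact: ch.
    by move=> s; apply: continuous_comp; [exact: cpath|exact: cX].
  have ff : 0 < f (-1) * f 1.
    rewrite lt_neqAle eq_sym mulf_neq0//= leNgt; apply/negP => neg.
    have [|||c _ fc] := @IVT R f (-1) 1 0; [lra|exact: continuous_subspaceT| |].
      rewrite ge_min le_max.
      have [f1|f1] : f 1 < 0 \/ 0 < f 1 by apply/orP; rewrite -neq_lt.
        by rewrite (ltW f1) orbT /=; apply/orP; left; nra.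
      by rewrite (ltW f1) orbT andbT; apply/orP; left; nra.
    by have := f0 c; rewrite fc eqxx.
  have [f1|f1] := ltP 0 (f 1).
    exists g, h; split=> // s s1; rewrite -pathE//; case: s1 => ->//.
    by move: ff; rewrite pmulr_lgt0.
  (* The opposite square root makes that common sign positive. *)
  exists (fun x => - g x), (fun x => - h x); split.
  - by move=> x; apply: continuousN; exact: cg.
  - by move=> x; apply: continuousN; exact: ch.
  - by move=> x /rt[c [c0 e1 e2]]; exists c; rewrite !sqrrN !(mulrN, mulNr) opprK.
  - move=> s s1; rewrite -pathE// oppr_gt0.
    have {}f1 : f 1 < 0 by rewrite lt_neqAle f0.
    by case: s1 => ->//; move: ff; rewrite nmulr_lgt0.
pose Phi x : 'rV[R]_i.+1 := \row_k
  (if (k < i)%N then coord1 (H x) k.+1 else Num.min (sq x - 9) (g x)).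
have cPhi : continuous Phi.
  apply: cont_row => k; under eq_fun do rewrite mxE.
  have [_|_] := boolP (k < i)%N; first exact: cont_coord1.
  by apply: cont_min => //; apply: cont_sub; [exact: csq|exact: cont_cst].
(* Contraction of the ball, in disk coordinates: the parametrization of [K3] extends to the whole
   cube by coning from 0. *)
pose q (y : 'rV[R]_i.+1) := `|y| *: X y.
have cq : continuous q by apply: cont_cone => // y /KX[].
have q1 y : `|y| <= 1 -> `|q y| <= 1.
  move=> y1; rewrite normrZ normr_id; have [->|/KX[X1 _]] := eqVneq y 0.
    by rewrite normr0 mul0r.
  by rewrite mulr_ile1.
have Phi0 x : `|x| <= 1 -> Phi x != 0.
  move=> /rt[c [c0 e1 e2]]; apply/eqP => /rowP Px.
  have u0 : usq (H x) = 0.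
    apply: big1_seq => -[|j] /=; rewrite mem_index_iota// => /andP[_ ji].
    rewrite ltnS in ji; have := Px (widen_ord (leqnSn i) (Ordinal ji)).
    by rewrite !mxE /= ji => ->; rewrite expr0n.
  have := Px ord_max; rewrite !mxE /= ltnn => smin.
  (* If [g = 0], then [t = 0] and [|x|^2 - 4 <= 0], so the minimum is at most [-5]. *)
  have g0 : g x != 0.
    apply/eqP => g0; move: e2; rewrite g0 mulr0 mul0r => /esym/eqP.
    rewrite mulf_eq0 gt_eqF//= => /eqP t0; move: e1 smin; rewrite g0 /a.
    by rewrite minElt; case: ifP; have := sqr_ge0 (h x); nra.
  apply: (notK2 x); apply/K2E; split=> //.
  move: smin; rewrite minElt.
  case: ifP => [_|_ g00]; last by rewrite g00 eqxx in g0.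
  by rewrite /sq u0; lra.
have [y [[y1 Gy]|[y1 [c c0 Gy]]]] := poincare_bohl (cont_comp cPhi cq).
  by have := Phi0 _ (q1 _ y1); rewrite Gy eqxx.
have y0 : y != 0 by rewrite -normr_gt0 y1.
have [X1 HX] := KX y y0; have qy : q y = X y by rewrite /q y1 scale1r.
have e0 := eucl_gt0 y0; have ei0 : 0 < (eucl y)^-1 by rewrite invr_gt0.
move: Gy; rewrite qy => /rowP Gy.
(* The equation reads [(eucl y)^-1 * y_k = - c * y_k] with [c >= 0], so [y_k] vanishes and [y] is a
   pole. *)
have yk k : (k < i)%N -> coord1 y k.+1 = 0.
  move=> ki; have ki1 : (k < i.+1)%N by rewrite ltnW.
  have := Gy (Ordinal ki1); rewrite !mxE /= ki HX coord1_param_u// coord1S.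
  by move: (y _ _) => z; nra.
have := Gy ord_max; rewrite !mxE /= ltnn; set s := y ord0 ord_max => smin.
have ys : coord1 y i.+1 = s by rewrite coord1S; congr (y _ _); exact: val_inj.
have yE : y = pole s.
  apply/rowP => k; rewrite mxE; case: eqVneq => [->//|km].
  have ki : (k < i)%N by rewrite ltn_neqAle -ltnS ltn_ord andbT.
  have := yk k ki; rewrite coord1S => <-; congr (y _ _); exact: val_inj.
have s1 : `|s| = 1.
  apply/le_anti; rewrite -[X in _ <= X]y1 coord_le_norm/=.
  rewrite -y1; apply: norm_le_coord => // k; rewrite yE mxE.
  by case: ifP; rewrite ?normr0.
have s1' : s = 1 \/ s = -1.
  by move/eqP: s1; rewrite eqr_norml => /andP[/orP[/eqP|/eqP] + _]; [left|right].
have h0 : 0 < h (X y) by rewrite yE; exact: hpole.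
have [c' [c'0 _ e2]] := rt _ X1.
have /K3E[k1 k2] := ellipsoid_paramK3 y0; rewrite -HX in k1 k2.
have u0 : usq (H (X y)) = 0.
  apply: big1_seq => -[|j] /=; rewrite mem_index_iota// => /andP[_ ji].
  by rewrite HX coord1_param_u// yk// mulr0 expr0n.
move: smin e2; rewrite /sq u0 k2.
have -> : coord1 (H (X y)) n ^+ 2 = 16 by rewrite u0 in k1; lra.
rewrite HX coord1_param_t ys => smin e2.
have /eqP[] := min_sign_contra s1' h0 ei0 c0 c'0 e2.
by rewrite -smin; congr (Num.min _ _); lra.
Qed.

End Obstruction.

(** * Cones over coordinate ellipsoids *)

Lemma homeomorphism_image (T U : topologicalType) (A : set T)
    (F : T -> U) (G : U -> T) :
  continuous F -> continuous G -> (forall x, A x -> G (F x) = x) ->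
  exists h : set_type A -> set_type (F @` A),
    homeomorphism h /\ forall x, set_val (h x) = F (set_val x).
Proof.
move=> cF cG GF.
have FA (x : set_type A) : (F @` A) (F (set_val x)).
  by exists (set_val x) => //; exact: set_valP.
have GA (y : set_type (F @` A)) : A (G (set_val y)).
  have [x Ax xy] := set_valP y.
  suff : A (G (\val y)) by [].
  by rewrite -xy GF.
exists (fun x => set_elt (FA x)); split=> //; split.
  by apply: cont_to_set_type; apply: cont_comp cF _; exact: cont_set_val.
exists (fun y => set_elt (GA y)); split.
- by apply: cont_to_set_type; apply: cont_comp cG _; exact: cont_set_val.
- by move=> x; apply: val_inj; rewrite /= GF//; exact: set_valP.
- move=> y; apply: val_inj; have [x Ax xy] := set_valP y.
  have e : F (G (\val y)) = \val y by rewrite -xy GF.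
  exact: e.
Qed.

Section Ellipsoid.
Variables (R : realType) (n : nat) (S : {set 'I_n}) (c : 'I_n -> R).
Hypothesis c_gt0 : forall l, 0 < c l.

Definition on_sq (x : 'rV[R]_n) := \sum_(l in S) (c l * x ord0 l) ^+ 2.
Definition off_sq (x : 'rV[R]_n) := \sum_(l in ~: S) x ord0 l ^+ 2.
(** Its half-axes are the inverses of the [c l], along the coordinate directions in [S]. *)
Definition ellipsoid : set 'rV[R]_n := [set x | on_sq x = 1 /\ off_sq x = 0].

Variable l0 : 'I_n.
Hypothesis l0S : l0 \in S.

Let k := #|S|.-1.
Let cardS : #|S| = k.+1. Proof. by rewrite prednK//; apply/card_gt0P; exists l0. Qed.
Let phi (j : 'I_k.+1) : 'I_n := enum_val (cast_ord (esym cardS) j).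
Let psi (l : 'I_n) : 'I_k.+1 := cast_ord cardS (enum_rank_in l0S l).

Let phiS j : phi j \in S. Proof. exact: enum_valP. Qed.
Let phiK : cancel phi psi.
Proof. by move=> j; rewrite /psi /phi enum_valK_in cast_ordKV. Qed.
Let psiK l : l \in S -> phi (psi l) = l.
Proof. by move=> lS; rewrite /psi /phi cast_ordK enum_rankK_in. Qed.

Let L (y : 'rV[R]_k.+1) : 'rV[R]_n :=
  \row_l (if l \in S then (c l)^-1 * y ord0 (psi l) else 0).
Let P (x : 'rV[R]_n) : 'rV[R]_k.+1 := \row_j (c (phi j) * x ord0 (phi j)).

Let cL : continuous L.
Proof.
apply: cont_row => l; under eq_fun do rewrite mxE.
have [_|_] := boolP (l \in S); last exact: cont_cst.
by apply: cont_mul; [exact: cont_cst|apply: cont_coord; exact: cont_id].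
Qed.

Let cP : continuous P.
Proof.
apply: cont_row => j; under eq_fun do rewrite mxE.
by apply: cont_mul; [exact: cont_cst|apply: cont_coord; exact: cont_id].
Qed.

Let sum_phi (F : 'I_n -> R) : \sum_j F (phi j) = \sum_(l in S) F l.
Proof.
rewrite [RHS](reindex_onto phi psi) => [|l lS]; last exact: psiK.
by apply: eq_bigl => j; rewrite phiS phiK eqxx.
Qed.

Let sq_P x : \sum_j P x ord0 j ^+ 2 = on_sq x.
Proof.
apply: etrans (sum_phi (fun l => (c l * x ord0 l) ^+ 2)).
by apply: eq_bigr => j _; rewrite mxE.
Qed.

Section Cone.
Variable apex : 'rV[R]_n.
Hypothesis apexS : forall l, l \in S -> apex ord0 l = 0.

Let nrm (y : 'rV[R]_k.+1) := Num.sqrt (\sum_j y ord0 j ^+ 2).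
(** A lift of the disk to the cone, fixing the base. As [apex] vanishes on [S], the projection [P]
    remains a left inverse. *)
Let F y := L y + (1 - nrm y) *: apex.

Let sumsq_ge0 (y : 'rV[R]_k.+1) : 0 <= \sum_j y ord0 j ^+ 2.
Proof. by apply: sumr_ge0 => j _; exact: sqr_ge0. Qed.

Let cF : continuous F.
Proof.
apply: cont_add => //; apply: cont_scale; last exact: cont_cst.
apply: cont_sub; first exact: cont_cst.
apply: cont_sqrt; apply: cont_sum => j _; apply: cont_sqr; apply: cont_coord.
exact: cont_id.
Qed.

Let PF y : P (F y) = y.
Proof.
apply/rowP => j; rewrite !mxE phiS apexS// mulr0 addr0 phiK mulrA mulfV ?mul1r//.
by rewrite gt_eqF.
Qed.

Let F_on y l : l \in S -> F y ord0 l = (c l)^-1 * y ord0 (psi l).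
Proof. by move=> lS; rewrite !mxE lS apexS// mulr0 addr0. Qed.

Let F_off y l : l \notin S -> F y ord0 l = (1 - nrm y) * apex ord0 l.
Proof. by move=> lS; rewrite !mxE (negbTE lS) add0r. Qed.

(** The union of the segments from [apex] ([r = 0]) to the ellipsoid ([r = 1]); the apex 0 gives the
    flat ball. *)
Definition cone_ball : set 'rV[R]_n :=
  [set x | exists r, [/\ 0 <= r <= 1, on_sq x = r ^+ 2 &
    forall l, l \notin S -> x ord0 l = (1 - r) * apex ord0 l]].

Let disk_image : F @` @unit_disk R k.+1 = cone_ball.
Proof.
apply/seteqP; split=> [_ [y y1 <-]|x [r [/andP[r0 r1] onx offx]]].
  exists (nrm y); split; last exact: F_off.
    by rewrite sqrtr_ge0 -sqrtr1 ler_sqrt.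
  by rewrite sqr_sqrtr// -sq_P PF.
have nP : nrm (P x) = r by rewrite /nrm sq_P onx sqrtr_sqr ger0_norm.
exists (P x); first by rewrite /unit_disk /= sq_P onx expr_le1.
apply/rowP => l; have [lS|lS] := boolP (l \in S).
  by rewrite F_on// mxE psiK// mulrA mulVf ?mul1r// gt_eqF.
by rewrite F_off// nP offx.
Qed.

Let sphere_image : F @` @unit_sphere R k = ellipsoid.
Proof.
apply/seteqP; split=> [_ [y y1 <-]|x [onx offx]].
  split; first by rewrite -sq_P PF.
  apply: big1 => l; rewrite finset.in_setC => lS.
  by rewrite F_off// /nrm (_ : \sum_j _ = 1)// sqrtr1 subrr mul0r expr0n.
exists (P x); first by rewrite /unit_sphere /= sq_P.
apply/rowP => l; have [lS|lS] := boolP (l \in S).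
  by rewrite F_on// mxE psiK// mulrA mulVf ?mul1r// gt_eqF.
rewrite F_off// /nrm sq_P onx sqrtr1 subrr mul0r.
move/eqP: offx; rewrite psumr_eq0 => [|j _]; last exact: sqr_ge0.
move=> /allP/(_ l (mem_index_enum _)).
by rewrite finset.in_setC lS /= sqrf_eq0 => /eqP.
Qed.

Lemma cone_ballP : bounds_ball ellipsoid cone_ball.
Proof.
have [h [hh hE]] :=
  homeomorphism_image cF cP (fun y _ => PF y) (A := @unit_disk R k.+1).
rewrite -disk_image; exists k, h; split=> //.
rewrite -sphere_image; apply/seteqP; split=> [_ [y y1 <-]|_ [y y1 <-]].
  by exists (set_val y).
have yD : unit_disk y by move: y1; rewrite /unit_sphere /unit_disk /= => ->.
by exists (set_elt yD) => //; rewrite hE.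
Qed.

Lemma knot_cone_base : knot ellipsoid.
Proof.
have [h [[ch [g [cg hK gK]]] _]] :=
  homeomorphism_image cF cP (fun y _ => PF y) (A := @unit_sphere R k).
by rewrite -sphere_image; exists k, g; split=> //; exists h; split.
Qed.

End Cone.

Lemma knot_ellipsoid : knot ellipsoid.
Proof. by apply: (@knot_cone_base 0) => l _; rewrite mxE. Qed.

Lemma convex_cone_ball0 : convex_set (cone_ball 0).
Proof.
have mem x : cone_ball 0 x <-> on_sq x <= 1 /\ forall l, l \notin S -> x ord0 l = 0.
  split=> [[r [/andP[r0 r1] -> h]]|[h1 h2]].
    by split=> [|l /h]; [rewrite expr_le1|rewrite mxE mulr0].
  exists (Num.sqrt (on_sq x)).
  rewrite sqr_sqrtr; last by apply: sumr_ge0 => l _; exact: sqr_ge0.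
  split=> //; first by rewrite sqrtr_ge0 -sqrtr1 ler_sqrt.
  by move=> l /h2 ->; rewrite mxE mulr0.
move=> x y la /[!inE] /mem[x1 x2] /mem[y1 y2]; apply/mem.
have [t0 t1] : 0 <= la%:num /\ la%:num <= 1 by split; [exact: ge0|exact: le1].
have E l : (conv la x y : 'rV[R]_n) ord0 l =
    la%:num * x ord0 l + (1 - la%:num) * y ord0 l.
  by rewrite -[conv la x y]/(la%:num *: x + (1 - la%:num) *: y) !mxE.
move: t0 t1 E; set t := la%:num; move: (conv la x y) => z t0 t1 E; split; last first.
  by move=> l lS; rewrite E x2// y2// !mulr0 addr0.
apply: (@le_trans _ _ (t * on_sq x + (1 - t) * on_sq y)); last by nra.
rewrite /on_sq !mulr_sumr -big_split /=; apply: ler_sum => l _.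
rewrite E -subr_ge0.
(* The convexity defect of a square is itself a nonnegative multiple of a square. *)
have -> : forall a b d : R, t * (d * a) ^+ 2 + (1 - t) * (d * b) ^+ 2 -
    (d * (t * a + (1 - t) * b)) ^+ 2 = t * (1 - t) * (d * (a - b)) ^+ 2.
  by move=> a b d; ring.
by rewrite mulr_ge0 ?sqr_ge0// mulr_ge0// subr_ge0.
Qed.

(** Keeps only the squared norms of points on a cone whose apex is at distance [|A|] from the
    origin; these suffice to separate the ball from another component. *)
Definition round_ball (A : R) (B : set 'rV[R]_n) : Prop := forall x, B x ->
  exists r, [/\ 0 <= r, r <= 1, on_sq x = r ^+ 2 &
    off_sq x = (1 - r) ^+ 2 * A ^+ 2].

Lemma ellipsoid_flat_ball :
  exists B, [/\ bounds_ball ellipsoid B, convex_set B & round_ball 0 B].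
Proof.
exists (cone_ball 0); split; [|exact: convex_cone_ball0|].
  by apply: cone_ballP => l _; rewrite mxE.
move=> x [r [/andP[r0 r1] onx offx]]; exists r; split=> //.
rewrite expr0n mulr0; apply: big1 => l; rewrite finset.in_setC => /offx->.
by rewrite mxE mulr0 expr0n.
Qed.

Lemma ellipsoid_cone_ball l1 A : l1 \notin S ->
  exists B, bounds_ball ellipsoid B /\ round_ball A B.
Proof.
move=> l1S; pose apex : 'rV[R]_n := \row_l (if l == l1 then A else 0).
exists (cone_ball apex); split.
  apply: cone_ballP => l lS; rewrite mxE; case: eqP => // ll1.
  by move: l1S; rewrite -ll1 lS.
move=> x [r [/andP[r0 r1] onx offx]]; exists r; split=> //.
rewrite /off_sq (bigD1 l1) ?finset.in_setC//= offx// mxE eqxx.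
rewrite big1 => [|l /andP[lS ll1]].
  by rewrite addr0 exprMn.
by rewrite finset.in_setC in lS; rewrite offx// mxE (negbTE ll1) mulr0 expr0n.
Qed.

Lemma closed_ellipsoid : closed ellipsoid.
Proof.
have con : continuous on_sq.
  apply: cont_sum => l _; apply: cont_sqr; apply: cont_mul; first exact: cont_cst.
  by apply: cont_coord; exact: cont_id.
have coff : continuous off_sq.
  by apply: cont_sum => l _; apply: cont_sqr; apply: cont_coord; exact: cont_id.
apply: closedI.
  apply: (@closed_comp _ _ on_sq [set x | x = 1]); last exact: closed_eq.
  by move=> x _; exact: con.
apply: (@closed_comp _ _ off_sq [set x | x = 0]); last exact: closed_eq.
by move=> x _; exact: coff.
Qed.

End Ellipsoid.

(** * The three components *)

(** Finitely many disjoint closed sets are open in their union, so the inverse of the canonical map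
    is continuous. *)
Lemma link_closed_disjoint (R : realType) n (I : finType) (F : I -> set 'rV[R]_n) :
  (forall k, knot (F k)) -> (forall k, closed (F k)) ->
  (forall j k, j <> k -> F j `&` F k = set0) -> link F.
Proof.
move=> knF clF disj; split=> //.
pose U := \bigcup_k F k.
have FU k (x : set_type (F k)) : U (set_val x) by exists k => //; exact: set_valP.
pose h (p : {k : I & set_type (F k)}) : set_type U :=
  set_elt (FU (projT1 p) (projT2 p)).
have exF (y : set_type U) : exists k, F k (\val y).
  by have [k _ ?] := set_valP y; exists k.
pose g (y : set_type U) : {k : I & set_type (F k)} :=
  existT _ (projT1 (cid (exF y)))
    (@set_elt _ (F (projT1 (cid (exF y)))) (\val y) (projT2 (cid (exF y)))).
(* By disjointness the component picked by choice is the given one. *)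
have gE y k (Fy : F k (\val y)) : g y = existT _ k (@set_elt _ (F k) _ Fy).
  rewrite /g; case: cid => j Fj /=; have [jk|jk] := pselect (j = k); last first.
    by have : (F j `&` F k) (\val y) by []; rewrite disj.
  by case: k / jk Fy => Fy; congr existT; exact: val_inj.
exists h; split=> //; split.
  move=> [k x] A nA.
  have ck : continuous (fun x : set_type (F k) => set_elt (FU k x)).
    by apply: cont_to_set_type; exact: cont_set_val.
  exact: (ck x A nA).
exists g; split=> [y|[k x]|y].
- have [k Fy] := exF y => A; rewrite (gE _ _ Fy) => -[_ /= [[W oW <-]]] /= Wy WA.
  (* Removing the other components makes [V] meet the union only inside [F k]. *)
  pose V := W `&` ~` \bigcup_(j in [set j | j <> k]) F j.
  have oV : open V.
    apply: openI => //; rewrite openC.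
    by apply: closed_bigcup => [|j _]; [exact: finite_finset|exact: clF].
  have Vy : V (\val y).
    split=> // -[j jk Fj]; have : (F j `&` F k) (\val y) by [].
    by rewrite disj.
  have nV : nbhs y (set_val @^-1` V).
    exact: (@cont_set_val _ U y V (open_nbhs_nbhs (conj oV Vy))).
  suff : nbhs y (g @^-1` A) by [].
  apply: filterS nV => z /= [Wz nz].
  have Fz : F k (\val z).
    have [j Fj] := exF z; have [<-//|jk] := pselect (j = k).
    by exfalso; apply: nz; exists j.
  by rewrite /= (gE _ _ Fz); exact: WA.
- have Fx : F k (\val (h (existT _ k x))) by exact: (set_valP x).
  by rewrite (gE _ _ Fx); congr existT; exact: val_inj.
- have [k Fy] := exF y; rewrite (gE _ _ Fy); exact: val_inj.
Qed.

Lemma sublink_closed_disjoint (R : realType) n (I : finType)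
    (F : I -> set 'rV[R]_n) (A : {set I}) :
  (forall k, knot (F k)) -> (forall k, closed (F k)) ->
  (forall j k, j <> k -> F j `&` F k = set0) -> link (sublink F (A := A)).
Proof.
move=> knF clF disj; apply: link_closed_disjoint => [k|k|j k jk]; first exact: knF.
  exact: clF.
by apply: disj => e; apply: jk; exact: val_inj.
Qed.

Section BorromeanLink.
Variables (R : realType) (n i : nat).
Hypotheses (i_gt0 : (0 < i)%N) (i_lt : (i < n.-1)%N).

Let n_gt0 : (0 < n)%N. Proof. by case: n i_lt. Qed.
Let i1n : (i.+1 < n)%N. Proof. by rewrite -ltn_predRL. Qed.

Definition blockwise (A : Type) (u v t : A) (l : nat) : A :=
  if (l < i)%N then u else if (l < n.-1)%N then v else t.

Lemma sum_blockwise (pu pv pt : bool) (cu cv ct : R) (x : 'rV[R]_n) :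
  \sum_(l < n | blockwise pu pv pt l) (blockwise cu cv ct l * x ord0 l) ^+ 2 =
  pu%:R * cu ^+ 2 * usq i x + pv%:R * cv ^+ 2 * vsq i x +
  pt%:R * ct ^+ 2 * coord1 x n ^+ 2.
Proof.
pose F l :=
  (blockwise pu pv pt l)%:R * (blockwise cu cv ct l) ^+ 2 * coord1 x l.+1 ^+ 2.
transitivity (\sum_(0 <= l < n) F l).
  rewrite big_mkord big_mkcond; apply: eq_bigr => l _; rewrite /F coord1S.
  have -> : Ordinal (ltn_ord l) = l by exact: val_inj.
  by case: ifP; rewrite ?mul0r// mul1r exprMn.
rewrite -[X in index_iota 0 X](prednK n_gt0) big_nat_recr//=.
rewrite (big_cat_nat (n := i))//=; last exact: ltnW.
have -> : F n.-1 = pt%:R * ct ^+ 2 * coord1 x n ^+ 2.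
  by rewrite /F /blockwise ltnn ltnNge (ltnW i_lt)/= prednK.
congr (_ + _ + _).
  rewrite /usq big_add1 mulr_sumr; apply: eq_big_nat => l /= li.
  by rewrite /F /blockwise li.
rewrite /vsq big_add1 mulr_sumr; apply: eq_big_nat => l /andP[il ln].
by rewrite /F /blockwise ltnNge il ln.
Qed.

Let sel (pu pv pt : bool) : {set 'I_n} := [set l : 'I_n | blockwise pu pv pt l]%SET.
Let wt (cu cv ct : R) (l : 'I_n) : R := blockwise cu cv ct l.

Let on_selE pu pv pt cu cv ct x : on_sq (sel pu pv pt) (wt cu cv ct) x =
  pu%:R * cu ^+ 2 * usq i x + pv%:R * cv ^+ 2 * vsq i x +
  pt%:R * ct ^+ 2 * coord1 x n ^+ 2.
Proof. by rewrite -sum_blockwise; apply: eq_bigl => l; rewrite inE. Qed.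

Let off_selE pu pv pt (x : 'rV[R]_n) : off_sq (sel pu pv pt) x =
  (~~ pu)%:R * usq i x + (~~ pv)%:R * vsq i x + (~~ pt)%:R * coord1 x n ^+ 2.
Proof.
have := sum_blockwise (~~ pu) (~~ pv) (~~ pt) 1 1 1 x; rewrite expr1n !mulr1 => <-.
apply: eq_big => [l|l _]; last by rewrite /blockwise !if_same mul1r.
by rewrite finset.in_setC inE /blockwise; case: ifP => // _; case: ifP.
Qed.

(** [ou], [ov], [ot] are the indices 0, [i], [n.-1], one in each block; they show the blocks
    nonempty and carry the apexes of the cones. *)
Let ou : 'I_n := Ordinal (leq_trans i_gt0 (leq_trans (leqnSn i) (ltnW i1n))).
Let ov : 'I_n := Ordinal (ltnW i1n).
Let ot : 'I_n := Ordinal (etrans (congr1 (leq^~ n) (prednK n_gt0)) (leqnn n)).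

Let S1 := sel true true false.
Let S2 := sel false true true.
Let S3 := sel true false true.
Let c1 := wt 2^-1 2^-1 2^-1.
Let c2 := wt 3^-1 3^-1 3^-1.
Let c3 := wt 1 1 4^-1.

Let wt_gt0 cu cv ct : 0 < cu -> 0 < cv -> 0 < ct -> forall l, 0 < wt cu cv ct l.
Proof.
by move=> u0 v0 t0 l; rewrite /wt /blockwise; case: ifP => // _; case: ifP.
Qed.

Let K1_ellipsoid : K1 R n = ellipsoid S1 c1.
Proof.
apply/seteqP; split=> x; rewrite (K1E i_lt) /ellipsoid /= on_selE off_selE /=.
  by move=> [h1 h2]; rewrite h2; split; lra.
move=> [h1 /eqP]; rewrite !mul0r !add0r mul1r sqrf_eq0 => /eqP h2; split=> //; lra.
Qed.

Let K2_ellipsoid : K2 R n i = ellipsoid S2 c2.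
Proof.
by apply/seteqP; split=> x; rewrite (K2E i_lt) /ellipsoid /= on_selE off_selE /=;
  move=> [h1 h2]; split; lra.
Qed.

Let K3_ellipsoid : K3 R n i = ellipsoid S3 c3.
Proof.
by apply/seteqP; split=> x; rewrite (K3E i_lt) /ellipsoid /= on_selE off_selE /=;
  move=> [h1 h2]; split; lra.
Qed.

Let c1_gt0 : forall l, 0 < c1 l. Proof. by apply: wt_gt0; rewrite invr_gt0. Qed.
Let c2_gt0 : forall l, 0 < c2 l. Proof. by apply: wt_gt0; rewrite invr_gt0. Qed.
Let c3_gt0 : forall l, 0 < c3 l. Proof. by apply: wt_gt0; rewrite ?invr_gt0. Qed.

Let ouE pu pv pt : (ou \in sel pu pv pt) = pu.
Proof. by rewrite inE /blockwise i_gt0. Qed.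
Let ovE pu pv pt : (ov \in sel pu pv pt) = pv.
Proof. by rewrite inE /blockwise ltnn i_lt. Qed.
Let otE pu pv pt : (ot \in sel pu pv pt) = pt.
Proof. by rewrite inE /blockwise ltnn ltnNge (ltnW i_lt). Qed.

Let ouS1 : ou \in S1. Proof. by rewrite ouE. Qed.
Let ovS2 : ov \in S2. Proof. by rewrite ovE. Qed.
Let ouS3 : ou \in S3. Proof. by rewrite ouE. Qed.

Lemma L_linkE (k : 'I_3) :
  L_link R n i k = nth set0 [:: K1 R n; K2 R n i; K3 R n i] k.
Proof. by rewrite /L_link (tnth_nth set0). Qed.

Lemma knot_L k : knot (L_link R n i k).
Proof.
rewrite L_linkE; case: k => [[|[|[|//]]] ? /=].
- rewrite K1_ellipsoid; exact: (knot_ellipsoid c1_gt0 ouS1).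
- rewrite K2_ellipsoid; exact: (knot_ellipsoid c2_gt0 ovS2).
- rewrite K3_ellipsoid; exact: (knot_ellipsoid c3_gt0 ouS3).
Qed.

Lemma closed_L k : closed (L_link R n i k).
Proof.
rewrite L_linkE; case: k => [[|[|[|//]]] ? /=].
- by rewrite K1_ellipsoid; exact: closed_ellipsoid.
- by rewrite K2_ellipsoid; exact: closed_ellipsoid.
- by rewrite K3_ellipsoid; exact: closed_ellipsoid.
Qed.

Let K12 x : K1 R n x -> ~ K2 R n i x.
Proof. by move=> /(K1E i_lt)[h1 h2] /(K2E i_lt)[h3 h4]; rewrite h2 in h3; lra. Qed.

Let K13 x : K1 R n x -> ~ K3 R n i x.
Proof. by move=> /(K1E i_lt)[h1 h2] /(K3E i_lt)[h3 h4]; rewrite h2 in h3; lra. Qed.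

Let K23 x : K2 R n i x -> ~ K3 R n i x.
Proof. by move=> /(K2E i_lt)[h1 h2] /(K3E i_lt)[h3 h4]; lra. Qed.

Lemma disjoint_L j k : j <> k -> L_link R n i j `&` L_link R n i k = set0.
Proof.
move=> jk; apply/seteqP; split=> // x []; rewrite !L_linkE.
case: j jk => [[|[|[|//]]] ?]; case: k => [[|[|[|//]]] ?] jk /= h1 h2.
all: try by case: jk; exact: val_inj.
- exact: K12 h1 h2.
- exact: K13 h1 h2.
- exact: K12 h2 h1.
- exact: K23 h1 h2.
- exact: K13 h2 h1.
- exact: K23 h2 h1.
Qed.

Lemma flat_ball_L k : exists B, bounds_ball (L_link R n i k) B /\ convex_set B.
Proof.
rewrite L_linkE; case: k => [[|[|[|//]]] ? /=].
- by rewrite K1_ellipsoid; have [B []] := ellipsoid_flat_ball c1_gt0 ouS1; exists B.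
- by rewrite K2_ellipsoid; have [B []] := ellipsoid_flat_ball c2_gt0 ovS2; exists B.
- by rewrite K3_ellipsoid; have [B []] := ellipsoid_flat_ball c3_gt0 ouS3; exists B.
Qed.

(** * Balls separating one component from another *)

Let avoids (K L : set 'rV[R]_n) := exists B, bounds_ball K B /\ B `&` L = set0.

Let avoidsI K L B : bounds_ball K B -> (forall x, B x -> ~ L x) -> avoids K L.
Proof. by move=> bB BL; exists B; split=> //; apply/seteqP; split=> // x [/BL]. Qed.

Let K1_avoids_K2 : avoids (K1 R n) (K2 R n i).
Proof.
rewrite K1_ellipsoid; have [B [bB _ rB]] := ellipsoid_flat_ball c1_gt0 ouS1.
apply: avoidsI bB _ => x /rB[r []]; rewrite on_selE off_selE /= => r0 r1 h1 h2.
by move/(K2E i_lt) => [h3 h4]; nra.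
Qed.

Let K2_avoids_K3 : avoids (K2 R n i) (K3 R n i).
Proof.
rewrite K2_ellipsoid; have [B [bB _ rB]] := ellipsoid_flat_ball c2_gt0 ovS2.
apply: avoidsI bB _ => x /rB[r []]; rewrite on_selE off_selE /= => r0 r1 h1 h2.
by move/(K3E i_lt) => [h3 h4]; nra.
Qed.

Let K3_avoids_K1 : avoids (K3 R n i) (K1 R n).
Proof.
rewrite K3_ellipsoid; have [B [bB _ rB]] := ellipsoid_flat_ball c3_gt0 ouS3.
apply: avoidsI bB _ => x /rB[r []]; rewrite on_selE off_selE /= => r0 r1 h1 h2.
by move/(K1E i_lt) => [h3 h4]; rewrite h4 in h1; nra.
Qed.

Let K1_avoids_K3 : avoids (K1 R n) (K3 R n i).
Proof.
have otS1 : ot \notin S1 by rewrite otE.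
(* With apex at [t = 8], a common point would satisfy [4 r^2 + 4 (1 - r)^2 = 1], but the left side
   is at least 2. *)
rewrite K1_ellipsoid; have [B [bB rB]] := ellipsoid_cone_ball c1_gt0 ouS1 8 otS1.
apply: avoidsI bB _ => x /rB[r []]; rewrite on_selE off_selE /= => r0 r1 h1 h2.
by move/(K3E i_lt) => [h3 h4]; nra.
Qed.

Let K2_avoids_K1 : avoids (K2 R n i) (K1 R n).
Proof.
have ouS2 : ou \notin S2 by rewrite ouE.
(* A common point would satisfy [9 r^2 + 9 (1 - r)^2 = 4], but the left side is at least 9/2,
   attained at [r = 1/2]. *)
rewrite K2_ellipsoid; have [B [bB rB]] := ellipsoid_cone_ball c2_gt0 ovS2 3 ouS2.
apply: avoidsI bB _ => x /rB[r []]; rewrite on_selE off_selE /= => r0 r1 h1 h2.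
by move/(K1E i_lt) => [h3 h4]; rewrite h4 in h1; have := sqr_ge0 (r - 2^-1); nra.
Qed.

Let K3_avoids_K2 : avoids (K3 R n i) (K2 R n i).
Proof.
have ovS3 : ov \notin S3 by rewrite ovE.
(* A common point would satisfy [16 r^2 + 36 (1 - r)^2 = 9], but the left side is at least 144/13,
   attained at [r = 9/13]. *)
rewrite K3_ellipsoid; have [B [bB rB]] := ellipsoid_cone_ball c3_gt0 ouS3 6 ovS3.
apply: avoidsI bB _ => x /rB[r []]; rewrite on_selE off_selE /= => r0 r1 h1 h2.
by move/(K2E i_lt) => [h3 h4]; have := sqr_ge0 (r - 9 / 13); nra.
Qed.

Let L_avoids j k : j <> k -> avoids (L_link R n i k) (L_link R n i j).
Proof.
rewrite !L_linkE; case: j => [[|[|[|//]]] ?]; case: k => [[|[|[|//]]] ?] //= jk.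
all: by case: jk; exact: val_inj.
Qed.

Lemma convex_brunnian_L : convex_brunnian_link (L_link R n i).
Proof.
split; last by move=> k; split; [exact: knot_L|exact: flat_ball_L].
split.
- exact: link_closed_disjoint knot_L closed_L disjoint_L.
- by rewrite card_ord.
- move=> [_ /(_ ord_max)[B [bB dB]]].
  have e0 := dB ord0; have e1 := dB (inord 1).
  rewrite !L_linkE /= inordK// /= in e0 e1 bB.
  apply: (K3_not_bounding i_gt0 i_lt bB); [apply: e0|apply: e1] => /(congr1 val)//=.
  by rewrite inordK.
- move=> A Aproper.
  split; first exact: sublink_closed_disjoint knot_L closed_L disjoint_L.
  move=> [k kA]; rewrite /sublink /=.
  (* A proper sublink has at most two components: a lone one bounds its flat ball, and otherwise the
     ball avoiding the single other component works. *)
  have [[j jA jk]|none] := pselect (exists2 j, j \in A & j <> k); last first.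
    have [B [bB _]] := flat_ball_L k; exists B; split=> // -[j jA] jk.
    by exfalso; apply: none; exists j => // e; apply: jk; exact: val_inj.
  have [B [bB BL]] := L_avoids jk; exists B; split=> // -[j' j'A] j'k /=.
  have -> // : j' = j.
  apply: contrapT => j'j; have : (#|A| < 3)%N.
    by have := proper_card Aproper; rewrite cardsT card_ord.
  rewrite ltnNge => /negP[]; apply: (@leq_trans #|(j' |: [set j; k])%SET|).
    rewrite cardsU1 cards2 !inE negb_or.
    by move/eqP: j'j => ->; move/eqP: j'k => ->; move/eqP: jk => ->.
  by apply/subset_leq_card/fintype.subsetP => l; rewrite !inE => /or3P[] /eqP->.
Qed.

End BorromeanLink.

Theorem theorem3p1 (R : realType) (n i : nat) :
  (3 <= n)%N -> (1 <= i <= n - 2)%N -> convex_brunnian_link (L_link R n i).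
Proof.
move=> n3 /andP[i1 i2]; apply: convex_brunnian_L => //.
by rewrite ltn_predRL -addn2 -(subnK (ltnW n3)) addn2 addn2.
Qed.
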